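(* Let $f\in\mathcal F$, let $t\in(0,\infty)$, and take $c>0$ such that $\int g_{1,c}(x)f(x)\,dx=t$. Let $k=k(n)$ be a sequence of integers with $1\le k(n)<n$. Consider the uniform probability density $h_{n,t}$ on $\mathcal S_n(t)$, and let $p_{n,k,t}$ be the distribution (density on $\mathbb R^k$) of its first $k$ coordinates. If $d_{TV}(p_{n,k,t},g_{k,c})\to0$ as $n\to\infty$, then $k/n\to0$. Hence also, if $D(p_{n,k,t}\,\|\,g_{k,c})\to0$ as $n\to\infty$, then $k/n\to0$.
   Context: Class $\mathcal F$: the set of functions $f:\mathbb R\to\mathbb R\cup\{\infty\}$ such that (1) $f(0)=0$ and $f$ is right continuous at $0$; (2) $f$ is differentiable for $x>0$ with $f'(x)>0$, and (2a) there exist $a_1,a_2$ with $f'(x)\ge a_1>0$ for $x\in(a_2,\infty)$, (2b) there exist $1<q<2$ and $a_3>0$ with $\liminf_{x\searrow 0} f'(x)^q/f(x)\ge a_3$; (3) either (a) $f(x)=\infty$ for all $x<0$, or (b) $f(x)=f(-x)$ for all $x$. Write $F=\{x: f(x)<\infty\}$. Notation: $R_n(\mathbf x)=\sum_{i=1}^n f(x_i)$; $\mathcal S_n(t)=\{\mathbf x\in F^n: R_n(\mathbf x)=nt\}$; $Z_c=\int_{\mathbb R}\exp(-cf(x))\,dx$; $g_{n,c}(\mathbf x)=\exp(-cR_n(\mathbf x))/Z_c^n$ (zero where $R_n=\infty$). Let $\sigma_{n,t}$ be the induced Riemannian volume on $\mathcal S_n(t)$. For $\mathbf x\in F^n\setminus\{\mathbf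 0\}$ let $S_{n,t}(\mathbf x)=\kappa\mathbf x$, where $\kappa>0$ is the unique number with $R_n(\kappa\mathbf x)=nt$. The Jacobian $A_{n,t}(r,\mathbf s)$, $r>0$, $\mathbf s\in\mathcal S_n(t)$, of the coordinates $\mathbf x\leftrightarrow(R_n(\mathbf x),S_{n,t}(\mathbf x))$ is determined by $\int_{F^n}\varphi(R_n(\mathbf x),S_{n,t}(\mathbf x))\,d\mathbf x=\int_{(0,\infty)\times\mathcal S_n(t)}\varphi(r,\mathbf s)A_{n,t}(r,\mathbf s)\,dr\,\sigma_{n,t}(d\mathbf s)$ for measurable $\varphi\ge0$. The ''uniform'' (microcanonical) probability density with respect to $\sigma_{n,t}$ on $\mathcal S_n(t)$ is $h_{n,t}(\mathbf v)=A_{n,t}(nt,\mathbf v)\big/\int A_{n,t}(nt,\mathbf s)\,\sigma_{n,t}(d\mathbf s)$ (note that $A_{n,t}(nt,\mathbf s)=1/|\nabla R_n(\mathbf s)|$ where the gradient exists and is non-zero). For probability densities $u,v$ on $\mathbb R^k$: $d_{TV}(u,v)=\int|u-v|$ and $D(u\|v)=\int u\log(u/v)$. *)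

(* Defs.v *)
From HB Require Import structures.
From mathcomp Require Import all_boot all_order all_algebra.
From mathcomp Require Import all_classical all_reals all_analysis.
From mathcomp Require Import measurable_realfun.
Import Order.TTheory GRing.Theory Num.Theory.
Import numFieldNormedType.Exports.
Set Implicit Arguments.
Unset Strict Implicit.
Unset Printing Implicit Defensive.
Local Open Scope classical_set_scope.
Local Open Scope ring_scope.
(* R^n with its Borel sigma-algebra. *)
Notation Rn R n := (n.-tuple (measurableTypeR R)).

Section lebesgue_tuple.
Context {R : realType}.
Local Open Scope ereal_scope.

Definition consRn n (p : measurableTypeR R * Rn R n) : Rn R n.+1 :=
  cons_tuple p.1 p.2.

Lemma measurable_consRn n : measurable_fun setT (@consRn n).
Proof.
exact: (@measurable_cons _ _ (measurableTypeR R * Rn R n)%type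
  (measurableTypeR R) fst n snd).
Qed.

Definition uncons_Rn n (x : Rn R n.+1) : measurableTypeR R * Rn R n :=
  (thead x, [tuple of behead x]).

Lemma measurable_uncons_Rn n : measurable_fun setT (@uncons_Rn n).
Proof.
apply/measurable_fun_pairP; split.
  exact: (measurable_tnth (ord0 : 'I_n.+1)).
exact: measurable_behead.
Qed.

Section step.
Variables (n : nat) (m : {sigma_finite_measure set (Rn R n) -> \bar R}).

Definition lebesgue_cons : set (Rn R n.+1) -> \bar R :=
  pushforward (@lebesgue_measure R \x m) (@consRn n).

Let lebesgue_cons0 : lebesgue_cons set0 = 0.
Proof. by rewrite /lebesgue_cons /pushforward preimage_set0 measure0. Qed.

Let lebesgue_cons_ge0 A : 0 <= lebesgue_cons A.
Proof. by rewrite /lebesgue_cons /pushforward measure_ge0. Qed.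

Let lebesgue_cons_sigma_additive : semi_sigma_additive lebesgue_cons.
Proof.
move=> F mF tF mUF.
have mp A : measurable A -> measurable (@consRn n @^-1` A).
  by move=> mA; rewrite -[X in measurable X]setTI; exact: measurable_consRn.
rewrite /lebesgue_cons /pushforward preimage_bigcup.
apply: measure_semi_sigma_additive.
- by move=> i; exact: mp.
- apply/trivIsetP => /= i j _ _ ij; rewrite -preimage_setI.
  by move/trivIsetP : tF => /(_ _ _ _ _ ij) ->//; rewrite preimage_set0.
- by rewrite -preimage_bigcup; exact: mp.
Qed.

HB.instance Definition _ := isMeasure.Build _ _ _ lebesgue_cons
  lebesgue_cons0 lebesgue_cons_ge0 lebesgue_cons_sigma_additive.

Let lebesgue_cons_sigma_finite : sigma_finite setT lebesgue_cons.
Proof.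
have /sigma_finiteP[F [TF ndF Foo]] := sigma_finiteT (@lebesgue_measure R).
have /sigma_finiteP[G [TG ndG Goo]] := sigma_finiteT m.
exists (fun k => @uncons_Rn n @^-1` (F k `*` G k)).
  rewrite -preimage_bigcup (_ : \bigcup_k _ = setT) ?preimage_setT//.
  rewrite -subTset => -[x y] _.
  have [i _ Fx] : (\bigcup_k F k) x by rewrite -TF.
  have [j _ Gy] : (\bigcup_k G k) y by rewrite -TG.
  exists (maxn i j) => //; split => /=.
  - by move: x Fx; exact/subsetPset/ndF/leq_maxl.
  - by move: y Gy; exact/subsetPset/ndG/leq_maxr.
move=> k; have [mF Fk] := Foo k; have [mG Gk] := Goo k.
have mFG : measurable (F k `*` G k) by exact: measurableX.
split; first by rewrite -[X in measurable X]setTI; exact: measurable_uncons_Rn.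
rewrite /lebesgue_cons /pushforward -comp_preimage.
rewrite (_ : _ \o _ = idfun); last first.
  by apply/funext => -[x y]; congr pair; exact/val_inj.
by rewrite preimage_id product_measure1E// lte_mul_pinfty// ge0_fin_numE.
Qed.

HB.instance Definition _ := @Measure_isSigmaFinite.Build _ _ _
  lebesgue_cons lebesgue_cons_sigma_finite.

End step.

Fixpoint lebesgue_Rn n : {sigma_finite_measure set (Rn R n) -> \bar R} :=
  match n with
  | 0 => @dirac _ (Rn R 0) [tuple] R
  | m.+1 => lebesgue_cons (lebesgue_Rn m)
  end.

End lebesgue_tuple.
(* An outer measure that is additive on sets separated by [u] makes the
   superlevel sets of [u] Caratheodory measurable. *)
Section separated.
Context {R : realType} {T : Type} (mu : {outer_measure set T -> \bar R}).
Variable u : T -> R.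
Hypothesis mu_sep : forall (A B : set T) (e : R), 0 < e ->
  (forall x y, A x -> B y -> e <= `|u x - u y|) ->
  (mu A + mu B <= mu (A `|` B))%E.

Lemma separated_caratheodory (a : R) : mu.-caratheodory [set x | a < u x].
Proof.
apply: le_caratheodory_measurable => X; set A := [set x | a < u x].
have [->|muX] := eqVneq (mu X) +oo%E; first exact: leey.
have muXfin : mu X \is a fin_num by rewrite ge0_fin_numE ?ltey ?outer_measure_ge0.
pose P k := X `&` [set x | a + k.+1%:R^-1 < u x].
pose D k := P k.+1 `\` P k.
have invS k : k.+2%:R^-1 < k.+1%:R^-1 :> R by rewrite ltf_pV2 ?posrE ?ltr_nat.
have PX k : (mu (P k) <= mu X)%E by apply: le_outer_measure => x [].
have PS k : P k `<=` P k.+1.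
  by move=> x [Xx /= ax]; split => //=; rewrite (lt_trans _ ax)// ltrD2l.
have PD k : (mu (P k) + mu (D k.+1) <= mu (P k.+2))%E.
  apply: (@le_trans _ _ (mu (P k `|` D k.+1))); last first.
    apply: le_outer_measure => x [/PS/PS//|]; by case.
  apply: (@mu_sep _ _ (k.+1%:R^-1 - k.+2%:R^-1)); first by rewrite subr_gt0.
  move=> x y [_ /= ax] [[Xy _] nP].
  have {nP}ay : u y <= a + k.+2%:R^-1.
    by rewrite leNgt; apply/negP => ay; apply: nP.
  rewrite (le_trans _ (ler_norm _))//.
  rewrite lerBrDr -addrA [leLHS]addrC.
  have -> : - k.+2%:R^-1 + u y + k.+1%:R^-1 = k.+1%:R^-1 + (u y - k.+2%:R^-1) by rewrite addrC; congr (_ + _); rewrite addrC.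
  by rewrite (le_trans _ (ltW ax))// addrC lerD2r lerBlDr.
have Dsum n : (\sum_(0 <= k < n.+1) mu (D k) <= mu (P n) + mu (P n.+1))%E.
  elim: n => [|n ih].
    rewrite big_nat1 (le_trans _ (leeDr _ (outer_measure_ge0 _ _)))//.
    by apply: le_outer_measure => x [].
  rewrite big_nat_recr//=; apply: (le_trans (leeD2r _ ih)).
  by rewrite -addeA addeCA leeD2l// PD.
have Doo : (\sum_(0 <= k <oo) mu (D k) < +oo)%E.
  apply: (@le_lt_trans _ _ (mu X + mu X)%E); last first.
    by rewrite -ge0_fin_numE ?adde_ge0 ?outer_measure_ge0// fin_numD muXfin.
  apply: lime_le; first by apply: is_cvg_nneseries => *; exact: outer_measure_ge0.
  apply: nearW => -[|n]; first by rewrite big_geq// adde_ge0// outer_measure_ge0.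
  by rewrite (le_trans (Dsum n))// leeD.
have tail0 := nneseries_tail_cvg Doo (fun k _ => outer_measure_ge0 mu (D k)).
have XA k : X `&` A `<=` P k `|` \bigcup_(j in ~` `I_k) D j.
  move=> x [Xx /= ax].
  have [j axj] : exists j, a + j.+1%:R^-1 < u x.
    have d0 : 0 < u x - a by rewrite subr_gt0.
    have [m _ /(_ _ (leqnn m)) /= mlt] := near_infty_natSinv_lt (PosNum d0).
    by exists m; rewrite -ltrBrDl.
  have ex : exists j, a + j.+1%:R^-1 < u x by exists j.
  case: (ex_minnP ex) => -[|m] am mmin.
    left; split => //=; rewrite (le_lt_trans _ am)// lerD2l.
    by rewrite lef_pV2 ?posrE// ler_nat.
  have [km|mk] := leqP k m.
    right; exists m; first by apply/negP; rewrite -leqNgt.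
    split => // -[_ /= axm]; have := mmin _ axm; by rewrite ltnn.
  left; split => //=; rewrite (le_lt_trans _ am)// lerD2l.
  by rewrite lef_pV2 ?posrE// ler_nat.
have bnd k : (mu (X `&` A) + mu (X `&` ~` A) <=
    mu X + \sum_(k <= j <oo) mu (D j))%E.
  apply: (@le_trans _ _ ((mu (P k) + \sum_(k <= j <oo) mu (D j)) +
      mu (X `&` ~` A))%E).
    rewrite leeD2r// (le_trans (le_outer_measure mu _ _ (XA k)))//.
    by rewrite (le_trans (outer_measureU2 _ _ _))// leeD2l// outer_measure_sigma_subadditive_tail.
  rewrite addeAC leeD2r//.
  apply: (@le_trans _ _ (mu (P k `|` (X `&` ~` A)))); last first.
    by apply: le_outer_measure => x [[]|[]].
  apply: (@mu_sep _ _ k.+1%:R^-1); first by rewrite invr_gt0.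
  move=> x y [_ /= ax] [_ /= /negP]; rewrite -leNgt => ya.
  rewrite (le_trans _ (ler_norm _))// lerBrDl (le_trans _ (ltW ax))//.
  by rewrite lerD2r.
have lim : (mu X + \sum_(k <= j <oo) mu (D j) @[k --> \oo] --> mu X + 0)%E.
  by apply: cvgeD; [exact: fin_num_adde_defl|exact: cvg_cst|exact: tail0].
rewrite adde0 in lim.
by apply: cvge_ge lim; apply: nearW => k; exact: bnd.
Qed.

End separated.

Section hausdorff.
Context {R : realType}.

Definition dist_Rn n (x y : Rn R n) : R :=
  Num.sqrt (\sum_(i < n) ((tnth x i : R) - tnth y i) ^+ 2).

Definition norm_Rn n (x : Rn R n) : R := dist_Rn x [tuple 0 | _ < n].

Definition unit_ball_volume m : R :=
  fine (lebesgue_Rn m [set x : Rn R m | norm_Rn x <= 1]).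

Definition diam n (C : set (Rn R n)) : \bar R :=
  ereal_sup [set (dist_Rn p.1 p.2)%:E | p in C `*` C].

(* Covers by pieces of diameter at most [delta]; [mu_ext] covers with Borel
   sets, which is no restriction since a set and its closure have the same
   diameter.  The factor [unit_ball_volume m / 2 ^+ m] makes the m-dimensional
   Hausdorff measure agree with the Riemannian volume on m-dimensional
   submanifolds.  The empty set is treated apart because [diam set0 = -oo]. *)
Definition hausdorff_weight n m (delta : R) (C : set (Rn R n)) : \bar R :=
  (if C == set0 then 0
   else if diam C <= delta%:E
   then (unit_ball_volume m / 2 ^+ m)%:E * diam C ^+ m else +oo)%E.

Definition hausdorff_measure n m (A : set (Rn R n)) : \bar R :=
  ereal_sup [set mu_ext (hausdorff_weight m delta) A
            | delta in [set delta : R | 0 < delta]].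

Section properties.
Variables n m : nat.
Local Notation w := (@hausdorff_weight n m).
Local Notation H := (@hausdorff_measure n m).

Lemma unit_ball_volume_ge0 k : 0 <= unit_ball_volume k.
Proof. by rewrite fine_ge0. Qed.

Lemma hausdorff_weight0 d : w d set0 = 0%E.
Proof. by rewrite /hausdorff_weight eqxx. Qed.

Lemma hausdorff_weight_ge0 d C : (0 <= w d C)%E.
Proof.
rewrite /hausdorff_weight; case: ifPn => // /set0P[x Cx]; case: ifP => // _.
rewrite mule_ge0 ?expe_ge0//.
  by rewrite lee_fin mulr_ge0 ?unit_ball_volume_ge0// invr_ge0 exprn_ge0.
apply: le_ereal_sup_tmp; exists (dist_Rn x x)%:E; last by rewrite lee_fin sqrtr_ge0.
by exists (x, x).
Qed.

Local Notation Hd d := (mu_ext (w d)).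

Lemma le_hausdorff d A : 0 < d -> (Hd d A <= H A)%E.
Proof. by move=> d0; apply: ereal_sup_ubound; exists d. Qed.

Lemma hausdorff_measure0 : H set0 = 0%E.
Proof.
apply/eqP; rewrite eq_le; apply/andP; split.
  apply: ge_ereal_sup => _ [d _ <-].
  by rewrite mu_ext0//; [exact: hausdorff_weight0|exact: hausdorff_weight_ge0].
rewrite -[leLHS](@mu_ext0 _ _ _ (w 1) (hausdorff_weight0 1) (hausdorff_weight_ge0 1)).
exact: le_hausdorff.
Qed.

Lemma hausdorff_measure_ge0 A : (0 <= H A)%E.
Proof.
rewrite (le_trans _ (le_hausdorff A (ltr01)))//.
exact/mu_ext_ge0/hausdorff_weight_ge0.
Qed.

Lemma le_hausdorff_measure : {homo H : A B / A `<=` B >-> (A <= B)%E}.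
Proof.
move=> A B AB; apply: ge_ereal_sup => _ [d d0 <-].
by rewrite (le_trans _ (le_hausdorff B d0))// le_mu_ext.
Qed.

Lemma hausdorff_measure_subadditive : sigma_subadditive H.
Proof.
move=> F; apply: ge_ereal_sup => _ [d d0 <-].
apply: (le_trans (mu_ext_sigma_subadditive (hausdorff_weight_ge0 d) F)).
apply: lee_nneseries => [i _ _|i _]; last exact: le_hausdorff.
exact/mu_ext_ge0/hausdorff_weight_ge0.
Qed.

HB.instance Definition _ := isOuterMeasure.Build R (Rn R n) H
  hausdorff_measure0 hausdorff_measure_ge0 le_hausdorff_measure
  hausdorff_measure_subadditive.

Lemma dist_tnth (x y : Rn R n) i : `|(tnth x i : R) - tnth y i| <= dist_Rn x y.
Proof.
rewrite -sqrtr_sqr ler_wsqrtr// (bigD1 i)//= lerDl sumr_ge0// => j _.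
exact: sqr_ge0.
Qed.

Lemma hausdorff_weight_le d e C : d <= e -> (w e C <= w d C)%E.
Proof.
move=> de; rewrite /hausdorff_weight; case: ifPn => // _.
case: (leP (diam C) d%:E) => [Cd|_]; last exact: leey.
by rewrite (le_trans Cd)// lee_fin.
Qed.

Lemma mu_ext_weight_le d e A : d <= e -> (Hd e A <= Hd d A)%E.
Proof.
move=> de; apply: le_ereal_inf_tmp => _ [F AF <-].
apply: (@le_trans _ _ (\sum_(k <oo) w e (F k))%E).
  by apply: ereal_inf_lbound; exists F.
by apply: lee_nneseries => [k _ _|k _]; [exact: hausdorff_weight_ge0|exact: hausdorff_weight_le].
Qed.

Lemma mu_ext_weight_sep (i : 'I_n) (A B : set (Rn R n)) (e d : R) :
  0 < d -> d < e ->
  (forall x y, A x -> B y -> e <= `|(tnth x i : R) - tnth y i|) ->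
  (Hd d A + Hd d B <= Hd d (A `|` B))%E.
Proof.
move=> d0 de sep; apply: le_ereal_inf_tmp => _ [F [mF ABF] <-].
pose FA k := if F k `&` A == set0 then set0 else F k.
pose FB k := if F k `&` B == set0 then set0 else F k.
have cov (E : set (Rn R n)) : E `<=` \bigcup_k F k ->
    (Hd d E <= \sum_(k <oo) w d (if F k `&` E == set0 then set0 else F k))%E.
  move=> EF; apply: ereal_inf_lbound.
  exists (fun k => if F k `&` E == set0 then set0 else F k) => //; split.
    by move=> k; case: ifP.
  move=> x Ex; have [k _ Fx] := EF _ Ex; exists k => //.
  by case: ifPn => // /eqP FE0; have : (F k `&` E) x by []; rewrite FE0.
apply: (le_trans (leeD (cov A _) (cov B _))).
- by move=> x Ax; apply: ABF; left.
- by move=> x Bx; apply: ABF; right.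
rewrite -nneseriesD; [|by move=> *; exact: hausdorff_weight_ge0..].
apply: lee_nneseries => [k _ _|k _].
  by rewrite adde_ge0// hausdorff_weight_ge0.
case: (eqVneq (F k `&` A) set0) => [_|/set0P[x [Fx Ax]]].
  by rewrite hausdorff_weight0 add0e; case: ifP => _; rewrite ?hausdorff_weight0 ?hausdorff_weight_ge0.
case: (eqVneq (F k `&` B) set0) => [_|/set0P[y [Fy By]]].
  by rewrite hausdorff_weight0 adde0.
have -> : w d (F k) = +oo%E; last exact: leey.
rewrite /hausdorff_weight ifF; last by apply/negbTE/set0P; exists x.
rewrite ifF//; apply/negbTE; rewrite -ltNge.
apply: (@lt_le_trans _ _ (dist_Rn x y)%:E).
  by rewrite lte_fin (lt_le_trans de)// (le_trans (sep _ _ Ax By))// dist_tnth.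
by apply: ereal_sup_ubound; exists (x, y).
Qed.

Lemma hausdorff_measure_sep (i : 'I_n) (A B : set (Rn R n)) (e : R) : 0 < e ->
  (forall x y, A x -> B y -> e <= `|(tnth x i : R) - tnth y i|) ->
  (H A + H B <= H (A `|` B))%E.
Proof.
move=> e0 sep.
have key (d d' : R) : 0 < d -> 0 < d' -> (Hd d A + Hd d' B <= H (A `|` B))%E.
  move=> d0 d'0; pose c := Num.min (Num.min d d') (e / 2).
  have c0 : 0 < c by rewrite !lt_min d0 d'0 divr_gt0.
  have ce : c < e.
    by rewrite (@le_lt_trans _ _ (e / 2)) ?ge_min ?lexx ?orbT// ltr_pdivrMr// ltr_pMr// ltr1n.
  apply: (@le_trans _ _ (Hd c A + Hd c B)%E).
    by apply: leeD; apply: mu_ext_weight_le; rewrite !ge_min lexx ?orbT.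
  by rewrite (le_trans (mu_ext_weight_sep c0 ce sep))// le_hausdorff.
have [->|HAB] := eqVneq (H (A `|` B)) +oo%E; first exact: leey.
have fin (E : set (Rn R n)) : E `<=` A `|` B -> H E \is a fin_num.
  move=> EAB; rewrite ge0_fin_numE ?hausdorff_measure_ge0//.
  by rewrite (le_lt_trans (le_hausdorff_measure EAB))// ltey.
have fA := fin A (@subsetUl _ A B); have fB := fin B (@subsetUr _ A B).
have fAB := fin _ (@subset_refl _ (A `|` B)).
have fdB d : 0 < d -> Hd d B \is a fin_num.
  move=> d0; rewrite ge0_fin_numE; last exact/mu_ext_ge0/hausdorff_weight_ge0.
  by rewrite (le_lt_trans (le_hausdorff B d0))// ltey_eq fB.
rewrite -leeBrDl//; apply: ge_ereal_sup => _ [d' d'0 <-].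
rewrite leeBrDl// addeC -leeBrDl; last exact: fdB.
apply: ge_ereal_sup => _ [d d0 <-].
by rewrite leeBrDl ?fdB// addeC key.
Qed.

Lemma measurable_caratheodory_hausdorff (A : set (Rn R n)) :
  measurable A -> H.-caratheodory A.
Proof.
move=> mA.
have mt (i : 'I_n) : measurable_fun [set: caratheodory_type H]
    (fun x : caratheodory_type H => tnth (x : Rn R n) i : measurableTypeR R).
  apply: (@measurability _ _ _ _ setT _ (@measurable_realfun.RGenOInfty.G R)).
    exact: measurable_realfun.RGenOInfty.measurableE.
  move=> _ [_ [a ->] <-]; rewrite setTI.
  rewrite (_ : _ @^-1` _ = [set x : Rn R n | a < (tnth x i : R)]); last first.
    by apply/seteqP; split => x /=; rewrite in_itv/= andbT.
  apply: (@separated_caratheodory R (Rn R n) H (fun x => tnth x i)).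
  exact: hausdorff_measure_sep.
have mid : measurable_fun [set: caratheodory_type H] (fun x => x : Rn R n).
  exact/measurable_fun_tnthP.
by have := mid measurableT A mA; rewrite setTI.
Qed.

Lemma hausdorff_measure_sigma_additive : semi_sigma_additive H.
Proof.
move=> F mF tF mUF; apply: (@caratheodory_measure_sigma_additive R (Rn R n) H).
- by move=> k; exact: measurable_caratheodory_hausdorff.
- by [].
- exact: measurable_caratheodory_hausdorff.
Qed.

HB.instance Definition _ := isMeasure.Build _ (Rn R n) R H
  hausdorff_measure0 hausdorff_measure_ge0 hausdorff_measure_sigma_additive.

End properties.
End hausdorff.

Section microcanonical.
Context {R : realType}.
Implicit Types (f : R -> \bar R) (t c : R).

Record classF f : Prop := ClassF {
  classF_gtNy : forall x, f x != -oo%E ;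
  classF_at0 : f 0 = 0%E ;
  classF_right_continuous : f x @[x --> 0^'+] --> 0%E ;
  classF_differentiable : forall x : R, 0 < x ->
    [/\ f x \is a fin_num, derivable (fine \o f) x 1
      & 0 < derive1 (fine \o f) x] ;
  classF_slope : exists a1 a2 : R,
    0 < a1 /\ forall x : R, a2 < x -> a1 <= derive1 (fine \o f) x ;
  classF_liminf : exists q a3 : R, [/\ 1 < q, q < 2, 0 < a3
    & (a3%:E <= limf_einf
        (fun x : R => (derive1 (fine \o f) x `^ q / fine (f x))%:E) 0^'+)%E] ;
  classF_left : (forall x : R, x < 0 -> f x = +oo%E) \/ (forall x : R, f x = f (- x))
}.

Definition Rsum f n (x : Rn R n) : \bar R := (\sum_(i < n) f (tnth x i))%E.

Definition Fn f n : set (Rn R n) := [set x : Rn R n | forall i, (f (tnth x i) < +oo)%E].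

Definition Slevel f n t : set (Rn R n) :=
  @Fn f n `&` [set x | Rsum f x = (n%:R * t)%:E].

Definition Zpart f c : \bar R :=
  \int[@lebesgue_measure R]_x expeR (- (c%:E * f x))%E.

(* [expeR -oo = 0], so this vanishes where [Rsum f x = +oo]. *)
Definition gibbs f c n (x : Rn R n) : R :=
  fine (expeR (- (c%:E * Rsum f x))%E) / fine (Zpart f c) ^+ n.

Definition scale_Rn n (a : R) (x : Rn R n) : Rn R n :=
  [tuple a * tnth x i | i < n].

Definition kappa f n t (x : Rn R n) : R :=
  xget 0 [set a : R | 0 < a /\ Rsum f (scale_Rn a x) = (n%:R * t)%:E].

Definition Sproj f n t (x : Rn R n) : Rn R n := scale_Rn (kappa f t x) x.

Definition set_coord n (x : Rn R n) (i : 'I_n) (y : R) : Rn R n :=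
  [tuple if j == i then y else tnth x j | j < n].

(* [fine] sends +oo to 0, so finiteness of [Rsum f] near the point has to be
   required separately from the existence of the partial derivatives. *)
Definition has_gradient f n (s : Rn R n) : Prop := forall i : 'I_n,
  (\forall y \near (tnth s i : R), (Rsum f (set_coord s i y) < +oo)%E) /\
  derivable (fun y : R => fine (Rsum f (set_coord s i y))) (tnth s i) 1.

Definition gradient f n (s : Rn R n) : Rn R n :=
  [tuple derive1 (fun y : R => fine (Rsum f (set_coord s i y))) (tnth s i)
  | i < n].

(* The induced Riemannian volume of the level set: (n-1)-dimensional Hausdorff
   measure, always integrated over subsets of [Slevel f t]. *)
Definition surface n : {measure set (Rn R n) -> \bar R} :=
  @hausdorff_measure R n n.-1.

(* The integral identity determines [A] only up to null sets and hence says
   nothing about the single slice r = n t; the last clause fixes that slice. *)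
Record is_jacobian f n t (A : R -> Rn R n -> R) : Prop := IsJacobian {
  jacobian_measurable : measurable_fun
    ([set z : measurableTypeR R * Rn R n | 0 < (z.1 : R) /\ Slevel f t z.2])
    (fun z : measurableTypeR R * Rn R n => A z.1 z.2) ;
  jacobian_ge0 : forall (r : R) s, 0 < r -> Slevel f t s -> 0 <= A r s ;
  jacobian_change_of_variables :
    forall phi : measurableTypeR R * Rn R n -> \bar R,
    measurable_fun [set: measurableTypeR R * Rn R n] phi -> (forall z, (0 <= phi z)%E) ->
    (\int[@lebesgue_Rn R n]_(x in @Fn f n) phi (fine (Rsum f x), Sproj f t x) =
     \int[@lebesgue_measure R]_(r in `]0%R, +oo[)
       \int[surface n]_(s in Slevel f t) (phi (r, s) * (A r s)%:E))%E ;
  jacobian_at_level : forall s, Slevel f t s ->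
    has_gradient f s -> norm_Rn (gradient f s) != 0 ->
    A (n%:R * t) s = (norm_Rn (gradient f s))^-1
}.

Definition microcanonical f n t (A : R -> Rn R n -> R) (v : Rn R n) : R :=
  A (n%:R * t) v /
  fine (\int[surface n]_(s in Slevel f t) (A (n%:R * t) s)%:E)%E.

Definition first_coords n k (x : Rn R n) : Rn R k :=
  [tuple nth 0 (x : seq R) i | i < k].

Record prob_density k (u : Rn R k -> R) : Prop := ProbDensity {
  prob_density_measurable : measurable_fun setT u ;
  prob_density_ge0 : forall x, 0 <= u x ;
  prob_density_int1 : (\int[@lebesgue_Rn R k]_x (u x)%:E = 1)%E
}.

(* [p] is a density of the law of the first [k] coordinates under the
   probability density [microcanonical] with respect to [surface n]. *)
Definition marginal_density f n t (A : R -> Rn R n -> R) k (p : Rn R k -> R) :=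
  prob_density p /\
  forall B : set (Rn R k), measurable B ->
    (\int[@lebesgue_Rn R k]_(x in B) (p x)%:E =
     \int[surface n]_(v in Slevel f t `&` (@first_coords n k @^-1` B))
       (microcanonical f t A v)%:E)%E.

Definition dTV k (u v : Rn R k -> R) : \bar R :=
  (\int[@lebesgue_Rn R k]_x `|u x - v x|%:E)%E.

Definition relative_entropy k (u v : Rn R k -> R) : \bar R :=
  (\int[@lebesgue_Rn R k]_x
     (if u x == 0%R then 0
      else if v x == 0%R then +oo
      else (u x * ln (u x / v x))%:E))%E.

End microcanonical.

(* Main.v *)
Require Import Defs.
From HB Require Import structures.
From mathcomp Require Import all_boot all_order all_algebra fingroup perm.
From mathcomp Require Import all_classical all_reals all_analysis.
From mathcomp Require Import measurable_realfun ring lra.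
Import Order.TTheory GRing.Theory Num.Theory.
Import numFieldNormedType.Exports.
Set Implicit Arguments.
Unset Strict Implicit.
Unset Printing Implicit Defensive.
Local Open Scope classical_set_scope.
Local Open Scope ring_scope.

(* Suppose [k >= eps n].  Cut the [n] coordinates into a bounded number [m] of
   blocks of size at most [k / 2], and let [S_j] be the sum of [f(x_i) - t] over
   the j-th block.  On the level set the [S_j] add up to zero.  Since the
   microcanonical law is exchangeable, any two blocks may be moved into the
   first [k] coordinates, so if [d_TV] tends to zero, then a bounded test function of
   [(S_i, S_j)] has almost the same mean as under the product measure, where the
   [S_j] are independent and centred with total variance of order [n]: the mean
   of the (truncated) square of [sum_j S_j] would then be both zero and of
   order [n].  The truncation error is controlled by fourth moments.
   Exchangeability holds because the Jacobian equals [1 / |grad R_n|] off the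
   points having a zero coordinate, which a monotonicity argument shows to be
   null for the (n-1)-dimensional Hausdorff measure. *)

(** Total variation controls only bounded test functions, and [f] is unbounded, so the second
    moments cannot be compared directly. The product of two block sums is therefore replaced by
    [truncated_corr], chosen so that its double sum keeps a sign on the level set however large the
    block sums are. The truncation level is a constant times the square root of the block size, the
    order of the standard deviation of a block sum. Every error is then linear in the block size,
    and the constants can be fixed one after another: the number of blocks, the truncation, the
    bound on [d_TV]. Since [f'] need not be continuous, the level set is not handled through smooth
    charts: null slices are found by counting cubes. The entropy half reduces to the other one by a
    Pinsker-type inequality. *)

(** * The one-variable potential: monotonicity, growth, measurability *)

Section potential.
Context {R : realType} (f : R -> \bar R) (hf : classF f).
Local Notation phi := (fine \o f).

Lemma potential_fin_num x : 0 < x -> f x \is a fin_num.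
Proof. by case/(classF_differentiable hf). Qed.

Lemma potential_derivable x : 0 < x -> derivable phi x 1.
Proof. by case/(classF_differentiable hf). Qed.

Lemma potential_continuous x : 0 < x -> {for x, continuous phi}.
Proof. by move=> /potential_derivable /derivable1_diffP /differentiable_continuous. Qed.

Lemma potential_mvt x y : 0 < x -> x < y ->
  exists2 z, x < z < y & phi y - phi x = derive1 phi z * (y - x).
Proof.
move=> x0 xy.
have [z||z] := @MVT R phi (derive1 phi) x y xy.
- rewrite in_itv/= => /andP[xz _]; rewrite derive1E; apply/derivableP.
  exact: potential_derivable (lt_trans x0 xz).
- apply: continuous_in_subspaceT => z; rewrite inE/= in_itv/= => /andP[xz _].
  exact: potential_continuous (lt_le_trans x0 xz).
by rewrite in_itv/= => ? ?; exists z.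
Qed.

Lemma potential_lt_pos x y : 0 < x -> x < y -> phi x < phi y.
Proof.
move=> x0 xy; have [z /andP[xz zy] e] := potential_mvt x0 xy.
rewrite -subr_gt0 e mulr_gt0 ?subr_gt0//.
by case: (classF_differentiable hf (lt_trans x0 xz)).
Qed.

Lemma potential_cvg0 : phi x @[x --> 0^'+] --> 0.
Proof. exact: fine_cvg (classF_right_continuous hf). Qed.

(** The limit at [0] gives only weak inequalities, hence the detour: [phi (x / 2) >= 0] as a bound
    on the limit, and [phi (x / 2) < phi x]. *)
Lemma potential_gt0 x : 0 < x -> 0 < phi x.
Proof.
move=> x0; have x20 : 0 < x / 2 by rewrite divr_gt0.
have hx : x / 2 < x by rewrite ltr_pdivrMr// ltr_pMr// ltr1n.
apply: (le_lt_trans _ (potential_lt_pos x20 hx)).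
apply: (cvgr_to_le potential_cvg0).
near=> y; apply/ltW/potential_lt_pos.
  by near: y; exact: nbhs_right_gt.
by near: y; exact: nbhs_right_lt.
Unshelve. all: by end_near. Qed.

Lemma potential0 : phi 0 = 0. Proof. by rewrite /= (classF_at0 hf). Qed.

Lemma potential_lt x y : 0 <= x -> x < y -> phi x < phi y.
Proof.
rewrite le_eqVlt => /predU1P[<-|]; last exact: potential_lt_pos.
by rewrite potential0; exact: potential_gt0.
Qed.

(** Merges the two alternatives for negative arguments: where [f] is finite, either [x >= 0] or [f]
    is even. *)
Lemma potential_abs x : (f x < +oo)%E -> f x = f `|x|.
Proof.
have [x0|x0 fx] := ltP x 0; last by rewrite ger0_norm.
by have [->//|->] := classF_left hf; rewrite ltr0_norm.
Qed.

Lemma potential_fin x : (f x < +oo)%E -> f x = (phi x)%:E.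
Proof.
move=> fx; rewrite /= fineK// fin_numE (classF_gtNy hf).
by move: fx; rewrite ltey => ->.
Qed.

Lemma fine_potential_ge0 x : 0 <= phi x.
Proof.
case: (ltgtP (f x) +oo%E) => [fx||/= ->//]; last by rewrite ltNge leey.
rewrite /= (potential_abs fx); have [->|x0] := eqVneq x 0.
  by rewrite normr0 (classF_at0 hf).
by apply/ltW/potential_gt0; rewrite normr_gt0.
Qed.

Lemma potential_ge0 x : (0 <= f x)%E.
Proof.
case: (ltgtP (f x) +oo%E) => [fx||/= ->//]; last by rewrite ltNge leey.
by rewrite (potential_fin fx) lee_fin fine_potential_ge0.
Qed.

(** Beyond [b] the slope is at least [a1]; up to [b] the choice [C = a1 * b] makes the lower bound
    nonpositive. This gives both the boundedness of level sets and the integrability of Gibbs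
    moments. *)
Lemma potential_growth : exists a C : R,
  0 < a /\ forall x, ((a * `|x| - C)%:E <= f x)%E.
Proof.
have [a1 [a2 [a10 slope]]] := classF_slope hf.
pose b := Num.max a2 1; have b0 : 0 < b by rewrite lt_max ltr01 orbT.
exists a1, (a1 * b); split=> // x.
case: (ltgtP (f x) +oo%E) => [fx||/= ->]; [|by rewrite ltNge leey|exact: leey].
rewrite (potential_fin fx) lee_fin /= (potential_abs fx) -mulrBr.
have [xb|bx] := leP `|x| b.
  apply: le_trans (fine_potential_ge0 _).
  by rewrite mulr_ge0_le0 ?(ltW a10)// subr_le0.
have [z /andP[bz zx]] := potential_mvt b0 bx.
move=> /eqP; rewrite subr_eq => /eqP /= ->.
rewrite ler_wpDr ?fine_potential_ge0// ler_wpM2r ?subr_ge0 ?(ltW bx)//.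
by apply: slope; rewrite (le_lt_trans _ bz)// le_max lexx.
Qed.

Lemma measurable_potential : measurable_fun [set: measurableTypeR R] f.
Proof.
have mpos : measurable_fun (`]0%R, +oo[%classic : set (measurableTypeR R)) f.
  apply: (@eq_measurable_fun _ _ _ _ _ (EFin \o phi)).
    move=> x; rewrite inE/= in_itv/= andbT => x0.
    by rewrite fineK// potential_fin_num.
  apply/measurable_EFinP; apply: open_continuous_measurable_fun => //.
  by move=> x; rewrite inE/= in_itv/= andbT; exact: potential_continuous.
have mneg : measurable_fun (`]-oo, 0%R[%classic : set (measurableTypeR R)) f.
  have [h|h] := classF_left hf.
    apply: (@eq_measurable_fun _ _ _ _ _ (cst +oo%E)) => // x.
    by rewrite inE/= in_itv/= => x0; rewrite h.
  apply: (@eq_measurable_fun _ _ _ _ _ (f \o -%R)) => [x _|]; first exact/esym/h.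
  apply: (@measurable_comp _ _ _ _ _ _ (`]0%R, +oo[%classic : set (measurableTypeR R))) => //.
  by move=> _ [x /= + <-]; rewrite !in_itv/= andbT oppr_gt0.
have -> : [set: measurableTypeR R] =
    `]-oo, 0%R[%classic `|` ([set 0] `|` `]0%R, +oo[%classic).
  apply/esym; rewrite -subTset => x _ /=; rewrite !in_itv/= andbT.
  by case: (ltgtP x 0) => ?; [left|right; right|right; left].
apply/measurable_funU => //; first exact: measurableU.
split=> //; apply/measurable_funU => //; split=> //.
exact: measurable_fun_set1.
Qed.

Lemma measurable_fine_potential : measurable_fun [set: measurableTypeR R] phi.
Proof. by apply: measurableT_comp; [exact: fine_measurable|exact: measurable_potential]. Qed.

End potential.

(** * Hausdorff null sets by box counting *)

Section hausdorff_null.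
Context {R : realType}.

Definition cube n (x : Rn R n) (r : R) : set (Rn R n) :=
  [set z | forall j, `|(tnth z j : R) - tnth x j| <= r].

Lemma measurable_cube n (x : Rn R n) (r : R) : measurable (cube x r).
Proof.
have -> : cube x r = \bigcap_(j in [set: 'I_n])
    ((fun z : Rn R n => (tnth z j : R) - tnth x j) @^-1` `[- r, r]%classic).
  apply/seteqP; split=> z /= h j; first by move=> _ /=; rewrite in_itv/= -ler_norml; exact: h.
  by have := h j I; rewrite /= in_itv/= -ler_norml.
apply: fin_bigcap_measurable => // j _; rewrite -[X in measurable X]setTI.
have mf : measurable_fun [set: Rn R n] (fun z : Rn R n => (tnth z j : R) - tnth x j).
  by apply: measurable_funB => //; exact: measurable_tnth.
exact: mf.
Qed.

Lemma dist_Rn_le n (x y : Rn R n) (r : R) : 0 <= r ->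
  (forall j, `|(tnth x j : R) - tnth y j| <= r) -> dist_Rn x y <= n%:R * r.
Proof.
move=> r0 h.
have -> : n%:R * r = Num.sqrt ((n%:R * r) ^+ 2) by rewrite sqrtr_sqr ger0_norm// mulr_ge0.
rewrite ler_wsqrtr//.
apply: (@le_trans _ _ (\sum_(i < n) r ^+ 2)).
  by apply: ler_sum => i _; rewrite -real_normK ?num_real// lerXn2r ?nnegrE.
rewrite sumr_const card_ord -[leLHS]mulr_natl exprMn; apply: ler_wpM2r; first exact: sqr_ge0.
by case: n {x y h} => [|n]; [rewrite expr0n|rewrite -natrX ler_nat expnS expn1 leq_pmulr].
Qed.

Lemma hausdorff_weight_cube n m (d : R) (x : Rn R n) (r : R) : 0 <= r ->
  n%:R * (2 * r) <= d ->
  (hausdorff_weight m d (cube x r) <=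
   (unit_ball_volume m / 2 ^+ m * (n%:R * (2 * r)) ^+ m)%:E)%E.
Proof.
move=> r0 hd; rewrite /hausdorff_weight ifF; last first.
  by apply/negbTE/set0P; exists x => j; rewrite subrr normr0.
have le : (diam (cube x r) <= (n%:R * (2 * r))%:E)%E.
  apply: ge_ereal_sup => _ [[u v] [/= hu hv] <-]; rewrite lee_fin.
  apply: dist_Rn_le => [|j]; first by rewrite mulr_ge0.
  rewrite -(subrK (tnth x j : R) (tnth u j)) -addrA (le_trans (ler_normD _ _))//.
  rewrite mulr2n mulrDl mul1r lerD// 1?distrC//.
have ge : (0%:E <= diam (cube x r))%E.
  apply: le_ereal_sup_tmp; exists (dist_Rn x x)%:E; last by rewrite lee_fin sqrtr_ge0.
  by exists (x, x) => //; split => j; rewrite subrr normr0.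
rewrite ifT; last by rewrite (le_trans le)// lee_fin.
have c0 : 0 <= unit_ball_volume m / 2 ^+ m :> R.
  by rewrite mulr_ge0 ?unit_ball_volume_ge0// invr_ge0 exprn_ge0.
case: (diam _) le ge => [e| |]//=; rewrite !lee_fin => le ge.
by rewrite -EFin_expe -EFinM lee_fin ler_wpM2l// lerXn2r ?nnegrE// (le_trans ge).
Qed.

(** Of order [N ^ m] cubes of side of order [1 / N] have total weight of order [1 / N] in dimension
    [m + 1]. *)
Lemma hausdorff_measure_cover0 n m (C : R) (S : set (Rn R n)) :
  (forall N, (0 < N)%N -> exists s : seq (Rn R n),
     (size s)%:R <= C * N%:R ^+ m /\
     forall z, S z -> exists2 x, x \in s & cube x (C / N%:R) z) ->
  hausdorff_measure m.+1 S = 0%E.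
Proof.
move=> cov; apply/eqP; rewrite eq_le hausdorff_measure_ge0 andbT.
apply: ge_ereal_sup => _ [d d0 <-]; apply/lee_addgt0Pr => e e0; rewrite add0e.
have C0 : 0 <= C.
  have [s [hs _]] := cov 1 erefl; move: hs; rewrite expr1n mulr1.
  exact: le_trans.
pose K := unit_ball_volume m.+1 / 2 ^+ m.+1 * (n%:R * (2 * C)) ^+ m.+1 * C : R.
(* For [N >= B] the first summand brings the diameters below [d], the second brings the total weight
   [K / N] below [e]. *)
pose B := n%:R * (2 * C) / d + K / e.
have K0 : 0 <= K.
  rewrite !mulr_ge0 ?unit_ball_volume_ge0// ?invr_ge0 ?exprn_ge0//.
  by rewrite !mulr_ge0.
have [N [N0 BN]] : exists N, (0 < N)%N /\ B <= N%:R.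
  exists (Num.truncn B).+1; split=> //; exact/ltW/truncnS_gt.
have [s [hs sS]] := cov N N0.
have NR0 : 0 < N%:R :> R by rewrite ltr0n.
have r0 : 0 <= C / N%:R by rewrite divr_ge0.
have hd : n%:R * (2 * (C / N%:R)) <= d.
  rewrite [2 * _]mulrA [leLHS]mulrA ler_pdivrMr// [d * _]mulrC -ler_pdivrMr//.
  by rewrite (le_trans _ BN)// lerDl divr_ge0// ltW.
have hK : K / N%:R <= e.
  rewrite ler_pdivrMr// [e * _]mulrC -ler_pdivrMr// (le_trans _ BN)// lerDr.
  by rewrite divr_ge0 ?(ltW d0)// !mulr_ge0.
pose w := unit_ball_volume m.+1 / 2 ^+ m.+1 * (n%:R * (2 * (C / N%:R))) ^+ m.+1 : R.
pose x0 : Rn R n := [tuple 0 | _ < n].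
pose F k := if (k < size s)%N then cube (nth x0 s k) (C / N%:R) else set0.
apply: (@le_trans _ _ (\sum_(k <oo) hausdorff_weight m.+1 d (F k))%E).
  apply: ereal_inf_lbound; exists F => //; split.
    by move=> k; rewrite /F; case: ifP => // _; exact: measurable_cube.
  move=> z Sz; have [x xs xz] := sS _ Sz.
  exists (index x s) => //; rewrite /F index_mem xs nth_index//.
rewrite (nneseries_split _ (size s)); last first.
  by move=> k _; exact: hausdorff_weight_ge0.
rewrite add0n [X in (_ + X)%E]eseries0 ?adde0; last first.
  by move=> k sk _; rewrite /F ltnNge sk/= hausdorff_weight0.
apply: (@le_trans _ _ (\sum_(0 <= k < size s) w%:E)%E).
  rewrite big_nat [leRHS]big_nat; apply: lee_sum => k /= ks; rewrite /F ks.
  exact: hausdorff_weight_cube.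
rewrite sumEFin lee_fin big_const_nat subn0 iter_addr_0 -mulr_natl.
apply: le_trans hK; rewrite /w.
have w0 : 0 <= unit_ball_volume m.+1 / 2 ^+ m.+1 * (n%:R * (2 * (C / N%:R))) ^+ m.+1 :> R.
  rewrite !mulr_ge0 ?unit_ball_volume_ge0// ?invr_ge0 ?exprn_ge0//.
  by rewrite !mulr_ge0.
apply: (le_trans (ler_wpM2r w0 hs)); rewrite le_eqVlt; apply/orP; left; apply/eqP.
have -> : n%:R * (2 * (C / N%:R)) = n%:R * (2 * C) * N%:R^-1 by rewrite !mulrA.
rewrite /K [(_ * N%:R^-1) ^+ _]exprMn exprVn [N%:R ^+ m.+1]exprS invfM.
have : N%:R ^+ m != 0 :> R by rewrite expf_neq0// gt_eqF.
move: (N%:R ^+ m) => y y0; move: ((n%:R * (2 * C)) ^+ m.+1) => z.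
move: (unit_ball_volume m.+1 / 2 ^+ m.+1) => u.
by field; rewrite y0 gt_eqF.
Qed.

End hausdorff_null.

(** * Coordinate slices of the level set are null *)

Section slice.
Context {R : realType} (f : R -> \bar R) (hf : classF f).
Local Notation phi := (fine \o f).

Lemma Rsum_fin n (s : Rn R n) : @Fn R f n s ->
  Rsum f s = (\sum_(j < n) phi (tnth s j))%:E.
Proof.
move=> Fs; rewrite -sumEFin /Rsum; apply: eq_bigr => j _.
exact: potential_fin hf _ (Fs j).
Qed.

Lemma Slevel_sum n t (s : Rn R n) : Slevel f t s ->
  \sum_(j < n) phi (tnth s j) = n%:R * t.
Proof. by move=> [Fs]; rewrite /= (Rsum_fin Fs) => -[]. Qed.

Lemma Slevel_abs n t (s : Rn R n) j : Slevel f t s ->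
  phi (tnth s j) = phi `|tnth s j|.
Proof. by move=> [Fs _]; rewrite /= [in LHS](potential_abs hf (Fs j)). Qed.

(** The bound is a natural number because it enters a cardinality in [surface_slice0]. *)
Lemma Slevel_bounded n t : exists M : nat, forall s : Rn R n, Slevel f t s ->
  forall j, `|tnth s j| <= M%:R.
Proof.
have [a [C [a0 gr]]] := potential_growth hf.
exists (Num.truncn ((n%:R * t + C) / a)).+1 => s Ss j.
apply/(le_trans _ (ltW (truncnS_gt _))).
rewrite ler_pdivlMr// mulrC -lerBlDr.
have := gr (tnth s j); rewrite (potential_fin hf); last by case: Ss => + _; apply.
rewrite lee_fin => /le_trans; apply.
rewrite -(Slevel_sum Ss) (bigD1 j)//= lerDl sumr_ge0// => k _.
exact: fine_potential_ge0.
Qed.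

(** Otherwise every [|s j|] would be at least [|s' j|], strictly at [j0], and the sum of the
    potentials would be larger at [s] than at [s'], although both points lie on the same level. So
    the differences [|s j| - |s j0|] determine [|s j0|] up to their own error. *)
Lemma sum_potential_gap n (s s' : Rn R n) t (i j0 : 'I_n) (e : R) : 0 <= e ->
  Slevel f t s -> Slevel f t s' -> tnth s i = 0 -> tnth s' i = 0 ->
  (forall j, j != i -> j != j0 ->
     `|tnth s' j| - `|tnth s' j0| <= `|tnth s j| - `|tnth s j0| + e) ->
  `|tnth s j0| <= `|tnth s' j0| + e.
Proof.
move=> e0 Ss Ss' si s'i h; rewrite leNgt; apply/negP => lt.
have hj0 : `|tnth s' j0| < `|tnth s j0| by rewrite (le_lt_trans _ lt)// lerDl.
suff : \sum_(j < n) phi (tnth s' j) < \sum_(j < n) phi (tnth s j).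
  by rewrite (Slevel_sum Ss) (Slevel_sum Ss') ltxx.
rewrite (bigD1 j0)//= [ltRHS](bigD1 j0)//=; apply: ltr_leD.
  rewrite -!/(phi _) (Slevel_abs j0 Ss) (Slevel_abs j0 Ss').
  exact: potential_lt.
apply: ler_sum => j jj0; rewrite -!/(phi _).
have [->|ji] := eqVneq j i; first by rewrite si s'i.
rewrite (Slevel_abs j Ss) (Slevel_abs j Ss').
have : `|tnth s' j| <= `|tnth s j|.
  have := h j ji jj0; lra.
by rewrite le_eqVlt => /predU1P[->//|ltj]; apply/ltW/potential_lt.
Qed.

Lemma truncn_eq_dist (a b : R) : 0 <= a -> 0 <= b ->
  Num.truncn a = Num.truncn b -> a <= b + 1.
Proof.
move=> a0 b0 ab; have := truncn_itv a0; have := truncn_itv b0.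
rewrite ab => /andP[hb _] /andP[_ ha].
by rewrite (le_trans (ltW ha))// -natr1 lerD2r.
Qed.

Lemma dist_sign (x y : R) : (x < 0) = (y < 0) -> `|x - y| = `| `|x| - `|y| |.
Proof.
have [y0 x0|y0] := ltP y 0; last by move=> /negbT; rewrite -leNgt => x0; rewrite (ger0_norm x0) (ger0_norm y0).
by rewrite [`|x|]ltr0_norm// [`|y|]ltr0_norm// -opprD normrN.
Qed.

(** By [sum_potential_gap] a point of the slice is determined, in a Lipschitz way, by its signs and
    the [n - 2] differences [|s j| - |s j0|]. Rounding these to multiples of [1 / N] yields a cover
    by cubes whose number has order [N ^ (n - 2)], one dimension less than the surface. *)
Lemma surface_slice0 n t (i : 'I_n) : (2 <= n)%N ->
  surface n (Slevel f t `&` [set s | tnth s i = 0]) = 0%E.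
Proof.
case: n i => [|[|n]]// i _.
have [M hM] := Slevel_bounded n.+2 t.
have [j0 j0i] : exists j0 : 'I_n.+2, j0 != i.
  exists (lift i ord0); rewrite eq_sym; exact: neq_lift.
pose A : {set 'I_n.+2} := (~: [set i; j0])%SET.
have cA : #|{: {j : 'I_n.+2 | j \in A}}| = n.
  rewrite card_sig; apply/eqP; by rewrite -(eqn_add2l #|[set i; j0]%SET|) cardsC card_ord cards2 (eq_sym i) j0i.

(* The [2] is for the radius: equal codes give [|s j0|] up to [1 / N] and the other coordinates up
   to [2 / N]. The product counts sign patterns and, after extracting [N ^ n], the rounded
   differences. *)
pose C : R := 2 + (2 ^ n.+2)%:R * (2 * M + 1)%:R ^+ n.
pose S := Slevel f t `&` [set s : Rn R n.+2 | tnth s i = 0].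
suff : hausdorff_measure n.+1 S = 0%E by [].
apply: (@hausdorff_measure_cover0 _ _ _ C) => N N0.
have NR0 : 0 < N%:R :> R by rewrite ltr0n.
pose Q := (2 * M * N)%N.
(* Adding [M] puts the differences into [[0, 2 M]], so that truncation yields a natural number at
   most [Q]. *)
pose d (s : Rn R n.+2) j := N%:R * (`|tnth s j| - `|tnth s j0| + M%:R) : R.
pose code (s : Rn R n.+2) : {ffun 'I_n.+2 -> bool} *
    {ffun {j : 'I_n.+2 | j \in A} -> 'I_Q.+1} :=
  ([ffun j => tnth s j < 0], [ffun j => inord (Num.truncn (d s (val j)))]).
(* An arbitrary point of the slice with code [c]; the default serves the codes that do not occur. *)
pose rep c := xget [tuple 0 | _ < n.+2] (S `&` [set s | code s = c]).
exists [seq rep c | c <- enum predT]; split.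
  rewrite size_map -cardT card_prod !card_ffun card_bool !card_ord cA natrM.
  apply: (@le_trans _ _ ((2 ^ n.+2)%:R * ((2 * M + 1)%:R ^+ n * N%:R ^+ n))).
    rewrite ler_wpM2l// -exprMn natrX lerXn2r ?nnegrE// -natrM ler_nat.
    by rewrite mulnDl mul1n /Q -addn1 leq_add2l.
  rewrite mulrA ler_wpM2r ?exprn_ge0// /C lerDr//.
move=> z Sz; pose z' := rep (code z).
exists z'; first by apply: map_f; rewrite mem_enum.
have [Sz' cz'] : (S `&` [set s | code s = code z]) z'.
  exact: (xgetPex [tuple 0 | _ < n.+2]) (ex_intro _ z (conj Sz erefl)).
have d0 s j : S s -> 0 <= d s j.
  move=> [Ss _]; rewrite mulr_ge0//.
  have := hM _ Ss j0; have := normr_ge0 (tnth s j); lra.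
have dQ s j : S s -> (Num.truncn (d s j) < Q.+1)%N.
  move=> Ss; rewrite truncn_lt_nat ?d0// -natr1 /Q.
  apply: (@le_lt_trans _ _ ((2 * M * N)%:R)); last by rewrite ltrDl.
  rewrite /d mulnC natrM ler_wpM2l// natrM.
  case: Ss => Ss _; have := hM _ Ss j; have := normr_ge0 (tnth s j0); lra.
have near (s s' : Rn R n.+2) : S s -> S s' -> code s = code s' ->
    `|tnth s j0| <= `|tnth s' j0| + N%:R^-1 /\ forall j, j \in A ->
    `|tnth s' j| - `|tnth s' j0| <= `|tnth s j| - `|tnth s j0| + N%:R^-1.
  move=> Ss Ss' [_ /ffunP cc].
  have h j : j \in A ->
      `|tnth s' j| - `|tnth s' j0| <= `|tnth s j| - `|tnth s j0| + N%:R^-1.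
    move=> jA; have := cc (exist _ j jA); rewrite !ffunE/= => /(congr1 (@nat_of_ord _)).
    rewrite !inordK ?dQ// => /esym /truncn_eq_dist; rewrite !d0// => /(_ isT isT).
    rewrite /d => hh; rewrite -(ler_pM2l NR0) [leRHS]mulrDr mulfV ?lt0r_neq0//.
    lra.
  split=> //; apply: sum_potential_gap Ss.1 Ss'.1 Ss.2 Ss'.2 _ => [|j ji jj0].
    by rewrite invr_ge0.
  by apply: h; rewrite !inE negb_or ji jj0.
have [u1 v1] := near _ _ Sz Sz' (esym cz').
have [u2 v2] := near _ _ Sz' Sz cz'.
have C2 : 2 / N%:R <= C / N%:R.
  by rewrite ler_wpM2r ?invr_ge0// /C lerDl mulr_ge0// exprn_ge0.
move=> j; apply: le_trans C2; rewrite dist_sign; last first.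
  by move: cz' => [/ffunP/(_ j)]; rewrite !ffunE => ->.
have N1 : 0 <= N%:R^-1 :> R by rewrite invr_ge0.
have [->|ji] := eqVneq j i; first by rewrite Sz.2 Sz'.2 subrr normr0 mulr_ge0.
rewrite ler_norml; have [->|jj0] := eqVneq j j0; first by apply/andP; split; lra.
have jA : j \in A by rewrite !inE negb_or ji jj0.
have := v1 _ jA; have := v2 _ jA => ? ?; apply/andP; split; lra.
Qed.

End slice.

(** * Coordinate permutations preserve Hausdorff measure *)

Section coordinate_permutation.
Context {R : realType}.

Definition perm_Rn n (s : {perm 'I_n}) (x : Rn R n) : Rn R n :=
  [tuple tnth x (s i) | i < n].

Lemma tnth_perm_Rn n (s : {perm 'I_n}) (x : Rn R n) i :
  tnth (perm_Rn s x) i = tnth x (s i).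
Proof. by rewrite tnth_mktuple. Qed.

Lemma perm_RnK n (s : {perm 'I_n}) : cancel (@perm_Rn n s) (perm_Rn (s^-1)%g).
Proof. by move=> x; apply: eq_from_tnth => i; rewrite !tnth_perm_Rn permKV. Qed.

Lemma perm_RnKV n (s : {perm 'I_n}) : cancel (perm_Rn (s^-1)%g) (@perm_Rn n s).
Proof. by move=> x; apply: eq_from_tnth => i; rewrite !tnth_perm_Rn permK. Qed.

Lemma measurable_perm_Rn n (s : {perm 'I_n}) : measurable_fun setT (@perm_Rn n s).
Proof.
apply/measurable_fun_tnthP => i.
rewrite (_ : _ \o _ = fun x : Rn R n => tnth x (s i)); first exact: measurable_tnth.
by apply/funext => x /=; rewrite tnth_perm_Rn.
Qed.

Lemma dist_perm_Rn n (s : {perm 'I_n}) (x y : Rn R n) :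
  dist_Rn (perm_Rn s x) (perm_Rn s y) = dist_Rn x y.
Proof.
rewrite /dist_Rn [in RHS](reindex_inj (@perm_inj _ s))/=.
by congr Num.sqrt; apply: eq_bigr => i _; rewrite !tnth_perm_Rn.
Qed.

Lemma hausdorff_weight_perm n m d (s : {perm 'I_n}) (C : set (Rn R n)) :
  hausdorff_weight m d (perm_Rn s @^-1` C) = hausdorff_weight m d C.
Proof.
rewrite /hausdorff_weight.
have -> : (perm_Rn s @^-1` C == set0) = (C == set0).
  apply/eqP/eqP => [h|->]; last by rewrite preimage_set0.
  apply/seteqP; split=> // x Cx.
  suff : (perm_Rn s @^-1` C) (perm_Rn (s^-1)%g x) by rewrite h.
  by rewrite /= perm_RnKV.
have -> // : diam (perm_Rn s @^-1` C) = diam C.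
congr ereal_sup; apply/seteqP; split=> _ [[x y] [/= Cx Cy] <-].
  by exists (perm_Rn s x, perm_Rn s y) => //=; rewrite dist_perm_Rn.
exists (perm_Rn (s^-1)%g x, perm_Rn (s^-1)%g y); first by split; rewrite /= perm_RnKV.
by rewrite dist_perm_Rn.
Qed.

Lemma hausdorff_measure_perm_le n m (s : {perm 'I_n}) (C : set (Rn R n)) :
  (hausdorff_measure m (perm_Rn s @^-1` C) <= hausdorff_measure m C)%E.
Proof.
apply: ge_ereal_sup => _ [d d0 <-]; apply: le_trans (le_hausdorff m C d0).
apply: le_ereal_inf_tmp => _ [F [mF CF] <-].
apply: ereal_inf_lbound; exists (fun k => perm_Rn s @^-1` F k).
  split=> [k|x /CF[k _ Fk]]; last by exists k.
  by rewrite -[X in measurable X]setTI; exact: measurable_perm_Rn.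
by apply: eq_eseriesr => k _; exact: hausdorff_weight_perm.
Qed.

Lemma hausdorff_measure_perm n m (s : {perm 'I_n}) (C : set (Rn R n)) :
  hausdorff_measure m (perm_Rn s @^-1` C) = hausdorff_measure m C.
Proof.
apply/eqP; rewrite eq_le hausdorff_measure_perm_le/=.
apply: le_trans (hausdorff_measure_perm_le m (s^-1)%g _).
rewrite (_ : perm_Rn _ @^-1` (_ @^-1` _) = C)//.
by apply/seteqP; split=> x /=; rewrite perm_RnKV.
Qed.

End coordinate_permutation.

(** * Integrals against the density of an image law *)

Section density.
Local Open Scope ereal_scope.
Context {R : realType}.
Import HBNNSimple.

(** On the right [w] occurs only through its integrals over preimages under [X]. Used once for [X]
    and once for [id], the formula shows that densities with the same such integrals give every [G]
    the same integral. *)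
Lemma ge0_integral_density_lim d d' (T : measurableType d) (U : measurableType d')
    (mu : {measure set T -> \bar R}) (D : set T) (X : T -> U) (w : T -> R)
    (G : U -> \bar R) (mG : measurable_fun setT G) :
  measurable D -> measurable_fun setT X -> measurable_fun D w ->
  (forall x, D x -> (0 <= w x)%R) -> (forall y, 0 <= G y) ->
  let g := nnsfun_approx measurableT mG in
  \int[mu]_(x in D) (G (X x) * (w x)%:E) =
  limn (fun n => \sum_(r \in range (g n))
    (r%:E * \int[mu]_(x in D `&` X @^-1` (g n @^-1` [set r])) (w x)%:E)).
Proof.
move=> mD mX mw w0 G0 g.
have mXD h : measurable_fun setT h -> measurable_fun D (h \o X : T -> R).
  by move=> mh; apply: measurable_funTS; exact: measurableT_comp.
have g0 n y : (0 <= g n y)%R by [].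
transitivity (limn (fun n => \int[mu]_(x in D) ((g n (X x))%:E * (w x)%:E))).
  rewrite -monotone_convergence//.
  - apply: eq_integral => x _; apply/esym/cvg_lim => //.
    by apply: cvgeZr => //; apply: cvg_nnsfun_approx.
  - move=> n; apply: (@eq_measurable_fun _ _ _ _ _ (EFin \o (fun x => (g n (X x) * w x)%R))) => //.
    apply/measurable_EFinP/measurable_funM => //; exact: mXD.
  - by move=> n x Dx; rewrite -EFinM lee_fin mulr_ge0// w0.
  - move=> x Dx m n mn; rewrite -!EFinM lee_fin ler_wpM2r ?w0//.
    exact/lefP/nd_nnsfun_approx.
apply/congr_lim/funext => n.
have mpre r : measurable (X @^-1` (g n @^-1` [set r])).
  by rewrite -[X in measurable X]setTI; exact: mX.
transitivity (\int[mu]_(x in D) (\sum_(r \in range (g n))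
    (r * \1_(X @^-1` (g n @^-1` [set r])) x * w x)%:E)).
  apply: eq_integral => x _; rewrite fsumEFin//.
  rewrite -mulr_fsuml -EFinM; congr (_ * _)%:E; exact: fimfunE.
rewrite ge0_integral_fsum//; last 2 first.
- move=> r; apply/measurable_EFinP/measurable_funM => //.
  by apply: measurable_funM => //; exact: measurable_funTS.
- by move=> r x Dx; rewrite lee_fin mulr_ge0// ?w0//; exact: nnfun_muleindic_ge0.
apply: eq_fsbigr => r /[!inE] -[y _ <-].
transitivity (\int[mu]_(x in D) ((g n y)%:E * (\1_(X @^-1` (g n @^-1` [set g n y])) x * w x)%:E)).
  by apply: eq_integral => x _; rewrite -EFinM mulrA.
rewrite ge0_integralZl_EFin//.
- congr (_ * _); rewrite setIC integral_mkcondl; apply: eq_integral => x _.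
  by rewrite /patch indicE; case: ifPn => _; rewrite ?mul1r ?mul0r.
- by move=> x Dx; rewrite lee_fin mulr_ge0// w0.
- by apply/measurable_EFinP/measurable_funM => //; exact: measurable_funTS.
Qed.

Lemma ge0_integral_density d d' (T : measurableType d) (U : measurableType d')
    (mu : {measure set T -> \bar R}) (nu : {measure set U -> \bar R})
    (D : set T) (X : T -> U) (w : T -> R) (q : U -> R) (G : U -> \bar R) :
  measurable D -> measurable_fun setT X -> measurable_fun D w ->
  (forall x, D x -> (0 <= w x)%R) ->
  measurable_fun setT q -> (forall y, (0 <= q y)%R) ->
  (forall B, measurable B -> \int[nu]_(y in B) (q y)%:E =
     \int[mu]_(x in D `&` X @^-1` B) (w x)%:E) ->
  measurable_fun setT G -> (forall y, 0 <= G y) ->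
  \int[nu]_y (G y * (q y)%:E) = \int[mu]_(x in D) (G (X x) * (w x)%:E).
Proof.
move=> mD mX mw w0 mq q0 e mG G0.
rewrite (ge0_integral_density_lim _ mG mD mX mw w0 G0).
have := @ge0_integral_density_lim _ _ U U nu setT id q G mG measurableT
  (@measurable_id _ U setT) mq (fun y _ => q0 y) G0.
move=> /= ->; apply/congr_lim/funext => n; apply: eq_fsbigr => r _.
congr (_ * _); rewrite setTI -e; first by [].
exact: measurable_funPTI.
Qed.

End density.

(** * The gradient at points without zero coordinates *)

Section gradient.
Context {R : realType} (f : R -> \bar R) (hf : classF f).
Local Notation phi := (fine \o f).

(** For [x < 0], finiteness of [f x] forces the even alternative, and the claims follow from those
    at [- x] by reflection. *)
Lemma potential_regular x : x != 0 -> (f x < +oo)%E ->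
  [/\ derivable phi x 1, derive1 phi x != 0 & \forall y \near x, (f y < +oo)%E].
Proof.
have pos y : 0 < y ->
    [/\ derivable phi y 1, derive1 phi y != 0 & \forall z \near y, (f z < +oo)%E].
  move=> y0; have [_ dy /lt0r_neq0 dy0] := classF_differentiable hf y0; split=> //.
  near=> z; rewrite ltey_eq potential_fin_num//.
  by near: z; exact: lt_nbhsr.
have [x0 _ fx|x0 _ _|//] := ltgtP x 0.
  have fN : forall y, f y = f (- y).
    by case: (classF_left hf) => // h; move: fx; rewrite h// ltxx.
  have xN0 : 0 < - x by rewrite oppr_gt0.
  have [dx dx0 nx] := pos _ xN0.
  have phiN : phi = phi \o -%R by apply/funext => y /=; rewrite fN.
  have dN : derivable (-%R : R -> R) x 1.
    by apply: (@derivableN _ _ _ id); exact: derivable_id.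
  split.
  - rewrite phiN; apply/derivable1_diffP/differentiable_comp; first exact/derivable1_diffP/dN.
    exact/derivable1_diffP/dx.
  - have dNe : derive1 (-%R : R -> R) x = - 1.
      have := @derive1N R id x; rewrite derive1_id; apply; exact: derivable_id.
    by rewrite phiN (derive1_comp dN dx) dNe mulrN1 oppr_eq0.
  - move/nearN : nx; apply: filterS => y; by rewrite -fN.
exact: pos.
Unshelve. all: by end_near. Qed.

Lemma tnth_set_coord n (s : Rn R n) i y j :
  tnth (set_coord s i y) j = if j == i then y else tnth s j.
Proof. by rewrite tnth_mktuple. Qed.

(** Near [tnth s i] the sum is [phi] plus the constant contributed by the other coordinates. *)
Lemma has_gradient_generic n (s : Rn R n) : @Fn R f n s -> (forall i, tnth s i != 0) ->
  has_gradient f s /\ forall i, tnth (gradient f s) i = derive1 phi (tnth s i).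
Proof.
move=> Fs s0; suff h i : [/\ \forall y \near (tnth s i : R), (Rsum f (set_coord s i y) < +oo)%E,
    derivable (fun y : R => fine (Rsum f (set_coord s i y))) (tnth s i) 1 &
    derive1 (fun y : R => fine (Rsum f (set_coord s i y))) (tnth s i) =
    derive1 phi (tnth s i)].
  by split=> i; have [? ? ?] := h i => //; rewrite tnth_mktuple.
have [dx _ nx] := potential_regular (s0 i) (Fs i).
pose K := \sum_(j < n | j != i) phi (tnth s j).
have e y : (f y < +oo)%E -> Rsum f (set_coord s i y) = (phi y + K)%:E.
  move=> fy; rewrite Rsum_fin//; last first.
    by move=> j; rewrite tnth_set_coord; case: ifP.
  rewrite (bigD1 i)//= tnth_set_coord eqxx; congr (_ + _)%:E.
  by apply: eq_bigr => j /negbTE ji; rewrite /= tnth_set_coord ji.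
have ne : {near (tnth s i : R), phi + cst K =1 fun y : R => fine (Rsum f (set_coord s i y))}.
  by near=> y; rewrite e//; near: y.
split.
- by near=> y; rewrite e ?ltry//; near: y.
- apply: (near_eq_derivable ne (derivableD dx _)); exact: derivable_cst.
- rewrite !derive1E -(near_eq_derive _ ne) (deriveD dx); last exact: derivable_cst.
  by rewrite derive_cst addr0.
Unshelve. all: by end_near. Qed.

Lemma norm_gradient_generic n (s : Rn R n) : @Fn R f n s -> (forall i, tnth s i != 0) ->
  norm_Rn (gradient f s) = Num.sqrt (\sum_(i < n) derive1 phi (tnth s i) ^+ 2).
Proof.
move=> Fs s0; have [_ e] := has_gradient_generic Fs s0.
congr Num.sqrt; apply: eq_bigr => i _.
by rewrite e tnth_mktuple subr0.
Qed.

End gradient.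

(** * Measurability of the level set and of its generic points *)

Section exchangeability.
Context {R : realType} (f : R -> \bar R) (hf : classF f).
Local Notation phi := (fine \o f).

Lemma measurable_potential_tnth n (i : 'I_n) :
  measurable_fun setT (fun x : Rn R n => f (tnth x i)).
Proof.
apply: measurableT_comp; [exact: measurable_potential|exact: measurable_tnth].
Qed.

Lemma measurable_Rsum n : measurable_fun setT (@Rsum R f n).
Proof. by apply: emeasurable_sum => i; exact: measurable_potential_tnth. Qed.

Lemma measurable_Fn n : measurable (@Fn R f n).
Proof.
have -> : @Fn R f n = \bigcap_(i in [set: 'I_n])
    (fun x : Rn R n => f (tnth x i)) @^-1` (~` [set +oo%E]).
  apply/seteqP; split=> x h i => [_ /= fx|]; first by have := h i; rewrite fx ltxx.
  by rewrite ltey; apply/eqP; exact: h.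
apply: fin_bigcap_measurable => // i _; rewrite -[X in measurable X]setTI.
apply: measurable_potential_tnth => //. exact: measurableC (@emeasurable_set1 R +oo%E).
Qed.

Lemma measurable_Slevel n t : measurable (@Slevel R f n t).
Proof.
apply: measurableI; first exact: measurable_Fn.
rewrite -[X in measurable X]setTI.
exact: (@measurable_Rsum n measurableT [set (n%:R * t)%:E] (@emeasurable_set1 R _)).
Qed.

(** The points where [jacobian_at_level] is certain to apply: at a zero coordinate an even [f] may
    have a kink, and a one-sided [f] is infinite on the left. *)
Definition Sgeneric n t : set (Rn R n) :=
  Slevel f t `&` [set s | forall i, tnth s i != 0].

Lemma measurable_Sgeneric n t : measurable (@Sgeneric n t).
Proof.
apply: measurableI; first exact: measurable_Slevel.
have -> : [set s : Rn R n | forall i, tnth s i != 0] =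
    \bigcap_(i in [set: 'I_n]) (fun x : Rn R n => tnth x i) @^-1` (~` [set 0]).
  apply/seteqP; split=> x /= h i; first by move=> _ /= /eqP; exact/negP.
  by apply/eqP; exact: h.
apply: fin_bigcap_measurable => // i _; rewrite -[X in measurable X]setTI.
apply: measurable_tnth => //; exact: measurableC.
Qed.

Lemma surface_nongeneric0 n t : (2 <= n)%N ->
  surface n (@Slevel R f n t `\` @Sgeneric n t) = 0%E.
Proof.
move=> n2; apply: measure_negligible.
  by apply: measurableD; [exact: measurable_Slevel|exact: measurable_Sgeneric].
apply: (@negligibleS _ _ _ _ (\big[setU/set0]_(i < n)
    (Slevel f t `&` [set s : Rn R n | tnth s i = 0]))).
  move=> s [Ss ns].
  have [i si] : exists i, tnth s i = 0.
    apply: contrapT => h; apply: ns; split=> // i; apply/eqP => si; apply: h; by exists i.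
  by rewrite (bigD1 i)//=; left.
elim/big_ind : _ => [|A B|i _]; [exact: negligible_set0|exact: negligibleU|].
apply/negligibleP; last exact: surface_slice0.
apply: measurableI; first exact: measurable_Slevel.
rewrite -[X in measurable X]setTI; exact: (measurable_tnth i measurableT (measurable_set1 0)).
Qed.

End exchangeability.

(** * Exchangeability of the microcanonical law *)

Section microcanonical_symmetry.
Context {R : realType} (f : R -> \bar R) (hf : classF f) (t : R) (t0 : 0 < t).
Context (n : nat) (n2 : (2 <= n)%N) (A : R -> Rn R n -> R) (hA : is_jacobian f t A).
Local Notation phi := (fine \o f).
Local Notation h := (microcanonical f t A).

Let nt0 : 0 < n%:R * t.
Proof. by rewrite mulr_gt0// ltr0n (leq_trans _ n2). Qed.

Lemma measurable_jacobian_level : measurable_fun (Slevel f t) (A (n%:R * t)).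
Proof.
pose F := [set z : measurableTypeR R * Rn R n | 0 < (z.1 : R) /\ Slevel f t z.2].
have mF : measurable F.
  have -> : F = `]0, +oo[ `*` Slevel f t.
    by apply/seteqP; split=> -[r s] [/= r0 Ss]; split=> //=; move: r0; rewrite in_itv/= andbT.
  by apply: measurableX => //; exact: measurable_Slevel.
apply: (@measurable_comp _ _ _ _ _ _ F (fun z => A z.1 z.2) _ (pair (n%:R * t))) => //.
- by move=> _ [s Ss <-].
- exact: jacobian_measurable hA.
- by apply: measurable_funTS; exact: pair1_measurable.
Qed.

Lemma microcanonical_ge0 s : Slevel f t s -> 0 <= h s.
Proof.
move=> Ss; rewrite divr_ge0 ?(jacobian_ge0 hA)// fine_ge0// integral_ge0// => x Sx.
by rewrite lee_fin (jacobian_ge0 hA).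
Qed.

Lemma measurable_microcanonical : measurable_fun (Slevel f t) h.
Proof. by apply: measurable_funM => //; exact: measurable_jacobian_level. Qed.

Lemma Slevel_perm s (x : Rn R n) : Slevel f t (perm_Rn s x) <-> Slevel f t x.
Proof.
have imp (s' : {perm 'I_n}) (y : Rn R n) : Slevel f t y -> Slevel f t (perm_Rn s' y).
  move=> [Fy Ry]; split=> [i|]; first by rewrite tnth_perm_Rn.
  rewrite /= -Ry /Rsum [in RHS](reindex_inj (@perm_inj _ s'))/=.
  by apply: eq_bigr => i _; rewrite tnth_perm_Rn.
split=> [Sx|]; last exact: imp.
by have := imp (s^-1)%g _ Sx; rewrite perm_RnK.
Qed.

Lemma Sgeneric_perm s (x : Rn R n) : Sgeneric f t (perm_Rn s x) <-> Sgeneric f t x.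
Proof.
split=> -[/Slevel_perm Sx x0]; split=> // i.
  by have := x0 ((s^-1)%g i); rewrite tnth_perm_Rn permKV.
by rewrite tnth_perm_Rn.
Qed.

(** At generic points [A] is the inverse square root of the sum of the [f'(x_i) ^ 2], a symmetric
    function, and the normalising factor does not depend on the point. *)
Lemma microcanonical_perm s (x : Rn R n) : Sgeneric f t x -> h (perm_Rn s x) = h x.
Proof.
have jac y : Sgeneric f t y ->
    A (n%:R * t) y = (Num.sqrt (\sum_(i < n) derive1 phi (tnth y i) ^+ 2))^-1.
  move=> [Sy y0]; have [Fy _] := Sy.
  rewrite (jacobian_at_level hA Sy (has_gradient_generic hf Fy y0).1).
    by rewrite norm_gradient_generic.
  rewrite norm_gradient_generic// sqrtr_eq0 -ltNge.
  have i0 : 'I_n by case: (n) n2 => // m _; exact: ord0.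
  rewrite (bigD1 i0)//= ltr_wpDr ?sumr_ge0// => [i _|]; first exact: sqr_ge0.
  by rewrite exprn_even_gt0//=; have [] := potential_regular hf (y0 i0) (Fy i0).
move=> Sx; rewrite /microcanonical (jac _ Sx) (jac _ ((Sgeneric_perm s x).2 Sx)).
suff -> : \sum_(i < n) derive1 phi (tnth (perm_Rn s x) i) ^+ 2 =
    \sum_(i < n) derive1 phi (tnth x i) ^+ 2 by [].
rewrite [RHS](reindex_inj (@perm_inj _ s)).
by apply: eq_bigr => i _; rewrite tnth_perm_Rn.
Qed.

Lemma integral_Sgeneric (G : Rn R n -> \bar R) :
  measurable_fun (Slevel f t) G -> (forall x, Slevel f t x -> 0 <= G x)%E ->
  (\int[surface n]_(x in Slevel f t) G x = \int[surface n]_(x in Sgeneric f t) G x)%E.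
Proof.
move=> mG G0.
have mS : measurable (Slevel f t : set (Rn R n)) by exact: measurable_Slevel.
have mg : measurable (Sgeneric f t : set (Rn R n)) by exact: measurable_Sgeneric.
rewrite (@ge0_negligible_integral _ _ _ _ _ (Slevel f t `\` Sgeneric f t))//.
- by congr integral; rewrite setDD setIidr// => x [].
- exact: measurableD.
- exact: surface_nongeneric0.
Qed.

Lemma integral_microcanonical_perm s (G : Rn R n -> \bar R) :
  measurable_fun setT G -> (forall x, 0 <= G x)%E ->
  (\int[surface n]_(x in Slevel f t) (G (perm_Rn s x) * (h x)%:E) =
   \int[surface n]_(x in Slevel f t) (G x * (h x)%:E))%E.
Proof.
move=> mG G0.
have mh : measurable_fun (Slevel f t) (EFin \o h).
  by apply/measurable_EFinP; exact: measurable_microcanonical.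
have mGh : measurable_fun (Slevel f t) (fun x => G x * (h x)%:E)%E.
  by apply: emeasurable_funM => //; exact: measurable_funTS.
rewrite !integral_Sgeneric//; last 2 first.
- apply: emeasurable_funM => //; apply: measurable_funTS.
  by apply: measurableT_comp => //; exact: measurable_perm_Rn.
- by move=> x Sx; rewrite mule_ge0// lee_fin microcanonical_ge0.
have mg : measurable (Sgeneric f t : set (Rn R n)) by exact: measurable_Sgeneric.
(* The surface measure is its own image under [perm_Rn s], so the change of variables leaves only
   the invariance of [h], known on generic points. *)
transitivity (\int[pushforward (surface n) (perm_Rn s)]_(x in Sgeneric f t)
    (G x * (h x)%:E))%E; last first.
  congr integral; apply/funext => B; exact: hausdorff_measure_perm.
rewrite (ge0_integral_pushforward (measurable_perm_Rn s))//.
- have -> : perm_Rn s @^-1` Sgeneric f t = Sgeneric f t.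
    apply/predeqP => x; exact: Sgeneric_perm.
  by apply: eq_integral => x; rewrite inE => Sx /=; rewrite microcanonical_perm.
- by apply: measurable_funS mGh => //; [exact: measurable_Slevel|move=> x []].
- by move=> x; rewrite inE => -[Sx _]; rewrite mule_ge0// lee_fin microcanonical_ge0.
by move=> x Sx; rewrite mule_ge0// lee_fin microcanonical_ge0.
Qed.

End microcanonical_symmetry.

(** * Integrability and value of real integrals *)

Section has_integral.
Context {R : realType}.
Local Open Scope ereal_scope.

(** Integrability travels with the value, so that a moment computation amounts to combining such
    facts and checking a polynomial identity. *)
Definition has_integral d (T : measurableType d) (mu : {measure set T -> \bar R})
    (F : T -> R) (v : R) :=
  mu.-integrable setT (EFin \o F) /\ \int[mu]_x (F x)%:E = v%:E.

Section algebra.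
Context d (T : measurableType d) (mu : {measure set T -> \bar R}).
Implicit Types (F G : T -> R) (u v : R).
Local Notation hint := (has_integral mu).

Lemma has_integralD F G u v : hint F u -> hint G v ->
  hint (fun x => F x + G x)%R (u + v)%R.
Proof.
move=> [iF eF] [iG eG]; split; first exact: (integrableD measurableT iF iG).
under eq_integral do rewrite EFinD.
by rewrite integralD// eF eG.
Qed.

Lemma has_integralZ F v (a : R) : hint F v -> hint (fun x => a * F x)%R (a * v)%R.
Proof.
move=> [iF eF]; split; first exact: (integrableZl measurableT a iF).
under eq_integral do rewrite EFinM.
by rewrite integralZl// eF.
Qed.

Lemma has_integral_ext F G v : (forall x, F x = G x) -> hint F v -> hint G v.
Proof. by move=> /funext ->. Qed.

Lemma has_integral_le F G u v : hint F u -> hint G v ->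
  (forall x, F x <= G x)%R -> (u <= v)%R.
Proof.
move=> [iF eF] [iG eG] FG; rewrite -lee_fin -eF -eG.
by apply: le_integral => // x _; rewrite lee_fin.
Qed.

Lemma has_integral_measurable F v : hint F v -> measurable_fun setT F.
Proof. by move=> [/measurable_int /measurable_EFinP]. Qed.

Lemma has_integral_dominated F G v : measurable_fun setT F ->
  (forall x, `|F x| <= G x)%R -> hint G v -> exists u, hint F u.
Proof.
move=> mF FG [iG eG]; have iF : mu.-integrable setT (EFin \o F).
  apply: le_integrable iG => //; first exact/measurable_EFinP.
  by move=> x _; rewrite /= lee_fin (le_trans (FG x))// ler_norm.
exists (fine (\int[mu]_x (F x)%:E)); split=> //.
by rewrite fineK//; exact: integrable_fin_num.
Qed.

End algebra.

Lemma has_integralM d1 d2 (T1 : measurableType d1) (T2 : measurableType d2)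
    (m1 : {sigma_finite_measure set T1 -> \bar R})
    (m2 : {sigma_finite_measure set T2 -> \bar R}) (F : T1 -> R) (G : T2 -> R) (u v : R) :
  has_integral m1 F u -> has_integral m2 G v ->
  has_integral (m1 \x m2) (fun z => F z.1 * G z.2)%R (u * v)%R.
Proof.
move=> hF hG; have mF := has_integral_measurable hF; have mG := has_integral_measurable hG.
case: hF hG => iF eF [iG eG].
have mFG : measurable_fun setT (EFin \o (fun z : T1 * T2 => F z.1 * G z.2)%R).
  apply/measurable_EFinP/measurable_funM; exact: measurableT_comp.
have iFG : (m1 \x m2).-integrable setT (EFin \o (fun z => F z.1 * G z.2)%R).
  apply/(integrable12ltyP _ _ mFG).
  under eq_integral => x _.
    under eq_integral do rewrite /= normrM EFinM.
    rewrite ge0_integralZl_EFin//; last exact/measurable_EFinP/measurableT_comp.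
    over.
  rewrite ge0_integralZr//; last 2 first.
  - by apply/measurable_EFinP; exact: measurableT_comp.
  - by rewrite integral_ge0// => x _; rewrite lee_fin.
  have /integrableP[_ fF] := iF; have /integrableP[_ fG] := iG.
  by rewrite lte_mul_pinfty ?ge0_fin_numE ?integral_ge0// => x _; rewrite lee_fin.
have in2 x : \int[m2]_y (F x * G y)%:E = (F x)%:E * v%:E.
  by rewrite -eG -(integralZl measurableT iG).
split=> //; rewrite -(integral12_prod_meas1 iFG)/= /fubini_F /=.
under eq_integral => x _ do rewrite in2.
by rewrite EFinM -eF -(integralZr measurableT iF).
Qed.

Lemma has_integral_consRn n (F : Rn R n.+1 -> R) v : measurable_fun setT F ->
  has_integral (@lebesgue_measure R \x lebesgue_Rn n) (F \o @consRn R n) v ->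
  has_integral (lebesgue_Rn n.+1) F v.
Proof.
move=> mF [iF eF]; have mE : measurable_fun setT (EFin \o F) by exact/measurable_EFinP.
split.
  exact: (integrable_pushforward (@measurable_consRn R n) mE iF measurableT).
rewrite -eF; exact: (integral_pushforward (@measurable_consRn R n) mE iF measurableT).
Qed.

End has_integral.

(** On the positive half-line the integrand is [b^-1] times an exponential density; symmetry doubles
    the integral. *)
Lemma has_integral_expR_abs (R : realType) (b : R) : 0 < b ->
  exists v, has_integral (@lebesgue_measure R) (fun x => expR (- (b * `|x|))) v.
Proof.
move=> b0; set F := fun x : R => expR (- (b * `|x|)).
have cF : continuous F.
  move=> x; apply: continuous_comp; last exact: continuous_expR.
  apply: continuousN; apply: continuousM; first exact: cst_continuous.
  exact: norm_continuous.
have mF : measurable_fun setT F by exact: continuous_measurable_fun.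
have F0 x : 0 <= F x by exact: expR_ge0.
have i0 : (0 <= \int[@lebesgue_measure R]_x (F x)%:E)%E.
  by apply: integral_ge0 => x _; rewrite lee_fin.
have fin : (\int[@lebesgue_measure R]_x (F x)%:E < +oo)%E.
  rewrite ge0_symfun_integralT//; last by move=> x; rewrite /F /= normrN.
  rewrite lte_mul_pinfty//.
  apply: (@le_lt_trans _ _ (b^-1%:E * \int[@lebesgue_measure R]_x (exponential_pdf b x)%:E)%E); last first.
    by rewrite integral_exponential_pdf// mule1 ltry.
  rewrite -ge0_integralZl_EFin//; last 3 first.
  - by move=> x _; rewrite lee_fin exponential_pdf_ge0// ltW.
  - by apply/measurable_EFinP; exact: measurable_exponential_pdf.
  - by rewrite invr_ge0 ltW.
  rewrite [leLHS]integral_mkcond; apply: ge0_le_integral => //.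
  - by move=> x _; apply: erestrict_ge0 => y _; rewrite lee_fin.
  - apply/(measurable_restrictT _ _).1.
      rewrite (_ : [set x | _] = `[0, +oo[%classic) ; first exact: measurable_itv.
      by apply/seteqP; split => x/=; rewrite in_itv/= andbT.
    by apply/measurable_EFinP; exact: measurable_funTS.
  - by apply/measurable_EFinP; apply: measurable_funM => //; exact: measurable_exponential_pdf.
  move=> x _; rewrite /patch; case: ifPn => [|_].
    rewrite inE/= => x0; by rewrite -EFinM lee_fin exponential_pdfE// mulrA mulVf ?gt_eqF// mul1r mulNr /F ger0_norm.
  (* Off the half-line the restricted function takes the default value [point], which is [0]
     here. *)
  by rewrite -EFinM -[point]/(0%:E) lee_fin mulr_ge0 ?exponential_pdf_ge0 ?invr_ge0 ?ltW.
exists (fine (\int[@lebesgue_measure R]_x (F x)%:E)); split.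
  apply/integrableP; split; first exact/measurable_EFinP.
  by under eq_integral do rewrite /= ger0_norm//.
by rewrite fineK// ge0_fin_numE.
Qed.

(** * The Gibbs density on the line and its moments *)

Section gibbs_dimension_one.
Context {R : realType} (f : R -> \bar R) (hf : classF f) (t c : R) (t0 : 0 < t) (c0 : 0 < c)
  (hmean : (\int[@lebesgue_measure R]_x
       ((gibbs f c ([tuple x] : Rn R 1))%:E * f x) = t%:E)%E).
Local Notation phi := (fine \o f).
Local Notation leb := (@lebesgue_measure R).

Definition boltzmann (x : R) : R := fine (expeR (- (c%:E * f x))%E).
Definition gibbs1 (x : R) : R := boltzmann x / fine (Zpart f c).

Lemma gibbs_tuple1 x : gibbs f c ([tuple x] : Rn R 1) = gibbs1 x.
Proof. by rewrite /gibbs /Rsum big_ord1 expr1. Qed.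

Lemma boltzmann_fin x : (f x < +oo)%E -> boltzmann x = expR (- (c * phi x)).
Proof. by move=> fx; rewrite /boltzmann (potential_fin hf fx). Qed.

Lemma boltzmann_infty x : f x = +oo%E -> boltzmann x = 0.
Proof. by rewrite /boltzmann => ->; rewrite gt0_muley ?lte_fin. Qed.

Lemma boltzmannE x : (expeR (- (c%:E * f x)) = (boltzmann x)%:E)%E.
Proof.
case: (ltgtP (f x) +oo%E) => [fx||fx]; [|by rewrite ltNge leey|].
  by rewrite boltzmann_fin// (potential_fin hf fx).
by rewrite boltzmann_infty// fx gt0_muley ?lte_fin.
Qed.

Lemma boltzmann_ge0 x : 0 <= boltzmann x.
Proof. by rewrite fine_ge0// expeR_ge0. Qed.

Lemma ZpartE : Zpart f c = (\int[leb]_x (boltzmann x)%:E)%E.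
Proof. by apply: eq_integral => x _; rewrite boltzmannE. Qed.

(** If [Zpart f c] were [0] or [+oo], then [fine] would give [0], division by it would make the
    Gibbs density vanish, and the mean would be [0] instead of [t > 0]. *)
Lemma Zpart_gt0 : 0 < fine (Zpart f c).
Proof.
rewrite lt0r fine_ge0 ?andbT; last first.
  by rewrite ZpartE integral_ge0// => x _; rewrite lee_fin boltzmann_ge0.
apply/eqP => Z0; have := hmean; rewrite integral0_eq.
  by move=> [] e; move: t0; rewrite -e ltxx.
by move=> x _; rewrite gibbs_tuple1 /gibbs1 Z0 invr0 mulr0 mul0e.
Qed.

Lemma Zpart_fin : Zpart f c = (fine (Zpart f c))%:E.
Proof. by rewrite fineK//; case: (Zpart f c) Zpart_gt0 => //=; rewrite ltxx. Qed.

Lemma gibbs1_ge0 x : 0 <= gibbs1 x.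
Proof. by rewrite divr_ge0 ?boltzmann_ge0 ?(ltW Zpart_gt0). Qed.

Lemma measurable_boltzmann : measurable_fun setT boltzmann.
Proof.
pose D : set (measurableTypeR R) := f @^-1` (~` [set +oo%E]).
have mD : measurable D.
  rewrite -[X in measurable X]setTI; apply: (measurable_potential hf) => //.
  exact: measurableC (emeasurable_set1 _).
rewrite (_ : boltzmann = fun x => expR (- (c * phi x)) * \1_D x); last first.
  apply/funext => x; rewrite indicE /D; case: (ltgtP (f x) +oo%E) => [fx||fx].
  - by rewrite boltzmann_fin// mem_set ?mulr1//= => fy; move: fx; rewrite fy ltxx.
  - by rewrite ltNge leey.
  - by rewrite boltzmann_infty// memNset ?mulr0//=; apply.
apply: measurable_funM; last exact: measurable_indic.
apply: measurableT_comp => //; apply: measurableT_comp; first exact: oppr_measurable.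
by apply: measurable_funM => //; exact: measurable_fine_potential.
Qed.

Lemma measurable_gibbs1 : measurable_fun setT gibbs1.
Proof. by apply: measurable_funM => //; exact: measurable_boltzmann. Qed.

Lemma has_integral_gibbs1 : has_integral leb gibbs1 1.
Proof.
have e : (\int[leb]_x (gibbs1 x)%:E = 1)%E.
  under eq_integral do rewrite /gibbs1 EFinM.
  rewrite ge0_integralZr//; last 3 first.
  - by apply/measurable_EFinP; exact: measurable_boltzmann.
  - by move=> x _; rewrite lee_fin boltzmann_ge0.
  - by rewrite lee_fin invr_ge0 ltW// Zpart_gt0.
  by rewrite -ZpartE Zpart_fin -EFinM mulfV// gt_eqF// Zpart_gt0.
split=> //; apply/integrableP; split; first by apply/measurable_EFinP; exact: measurable_gibbs1.
under eq_integral do rewrite /= ger0_norm ?gibbs1_ge0//.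
by rewrite e ltry.
Qed.

(** A power of order at most [4] costs at most the factor [exp (c phi / 2)]; the remaining half of
    the exponent decays like [exp (- (c / 2) a |x|)] by the growth bound. *)
Lemma gibbs1_moment (j : nat) : (j <= 4)%N ->
  exists v, has_integral leb (fun x => (phi x - t) ^+ j * gibbs1 x) v.
Proof.
move=> j4; have [a [C [a0 gr]]] := potential_growth hf.
have b0 : 0 < c / 2 * a by rewrite mulr_gt0// divr_gt0.
have [v hv] := has_integral_expR_abs b0.
(* Chosen so that [|phi - t| <= B exp (c phi / 8)], from [y <= exp y] at [y = c phi / 8]; the fourth
   power of the exponential is [exp (c phi / 2)]. *)
pose B := t + 8 / c.
have B0 : 0 < B by rewrite addr_gt0// divr_gt0.
pose K := B ^+ j * (expR (c / 2 * C) / fine (Zpart f c)).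
have K0 : 0 <= K by rewrite mulr_ge0 ?exprn_ge0 ?(ltW B0)// divr_ge0 ?expR_ge0// ltW// Zpart_gt0.
apply: (has_integral_dominated _ _ (has_integralZ K hv)).
  apply: measurable_funM; last exact: measurable_gibbs1.
  apply: measurable_funX; apply: measurable_funB => //.
  exact: measurable_fine_potential.
move=> x; rewrite normrM (ger0_norm (gibbs1_ge0 x)).
case: (ltgtP (f x) +oo%E) => [fx||fx]; [|by rewrite ltNge leey|]; last first.
  by rewrite /gibbs1 boltzmann_infty// mul0r mulr0 mulr_ge0// expR_ge0.
have p0 := fine_potential_ge0 hf x.
have e1 : 1 <= expR (c * phi x / 8) by rewrite -expR0 ler_expR mulr_ge0// mulr_ge0// ltW.
have h1 : `|phi x - t| <= B * expR (c * phi x / 8).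
  rewrite (le_trans (ler_normB _ _))// (ger0_norm p0) gtr0_norm// mulrDl addrC lerD//.
    by rewrite ler_peMr// ltW.
  have := expR_ge1Dx (c * phi x / 8); set E := expR _ => hE.
  rewrite mulrAC ler_pdivlMr// mulrC; move: hE; rewrite /E; lra.
have h2 : `|(phi x - t) ^+ j| <= B ^+ j * expR (c / 2 * phi x).
  rewrite normrX (le_trans (lerXn2r _ _ _ h1))// ?nnegrE ?mulr_ge0 ?expR_ge0 ?(ltW B0)//.
  rewrite exprMn ler_wpM2l ?exprn_ge0 ?(ltW B0)// -expRM_natl ler_expR.
  have : (j%:R : R) <= 4 by rewrite (ler_nat _ _ 4).
  have cp : 0 <= c * phi x by rewrite mulr_ge0// ltW.
  rewrite -mulr_natl; nra.
rewrite (le_trans (ler_wpM2r (gibbs1_ge0 x) h2))// /K /gibbs1 (boltzmann_fin fx).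
have key : expR (c / 2 * phi x) * expR (- (c * phi x)) <=
    expR (c / 2 * C) * expR (- (c / 2 * a * `|x|)).
  rewrite -!expRD ler_expR.
  have := gr x; rewrite (potential_fin hf fx) lee_fin => grx.
  have : c / 2 * (a * `|x| - C) <= c / 2 * phi x by rewrite ler_wpM2l// divr_ge0 ?ltW.
  lra.
have := ler_wpM2l (divr_ge0 (exprn_ge0 j (ltW B0)) (ltW Zpart_gt0)) key.
set u1 := expR (c / 2 * phi x); set u2 := expR (- (c * phi x)); set u3 := expR (c / 2 * C); set u4 := expR (- (c / 2 * a * `|x|)).
set b := B ^+ j; set z := _^-1 => h.
rewrite [leLHS](_ : _ = b * z * (u1 * u2)); last by ring.
by rewrite [leRHS](_ : _ = b * z * (u3 * u4)); last by ring.
Qed.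

Lemma gibbs1_mean : has_integral leb (fun x => (phi x - t) * gibbs1 x) 0.
Proof.
have [v [iv ev]] := gibbs1_moment (isT : (1 <= 4)%N).
have h1 : has_integral leb (fun x => (phi x - t) * gibbs1 x) v by split.
suff ht : has_integral leb (fun x => phi x * gibbs1 x) t.
  rewrite -(subrr t) -[in X in _ - X](mulr1 t) -mulNr.
  apply: has_integral_ext (has_integralD ht (has_integralZ (- t) has_integral_gibbs1)) => x.
  ring.
have [i _] : has_integral leb (fun x => phi x * gibbs1 x) (v + t * 1).
  apply: has_integral_ext (has_integralD h1 (has_integralZ t has_integral_gibbs1)) => x.
  ring.
split=> //; rewrite -hmean; apply: eq_integral => x _.
rewrite gibbs_tuple1; case: (ltgtP (f x) +oo%E) => [fx||fx]; [|by rewrite ltNge leey|].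
  by rewrite [in RHS](potential_fin hf fx) -EFinM mulrC.
by rewrite /gibbs1 boltzmann_infty// !mul0r mulr0 mul0e.
Qed.

(** Zero variance would force [phi = t] almost everywhere on []0, 1[], where the density is
    positive, but a strictly increasing [phi] takes the value [t] at most once there. *)
Lemma gibbs1_variance_gt0 v :
  has_integral leb (fun x => (phi x - t) ^+ 2 * gibbs1 x) v -> 0 < v.
Proof.
move=> [iv ev].
have g0 x : (0 <= ((phi x - t) ^+ 2 * gibbs1 x)%:E)%E.
  by rewrite lee_fin mulr_ge0 ?sqr_ge0 ?gibbs1_ge0.
have v0 : 0 <= v by rewrite -lee_fin -ev integral_ge0.
rewrite lt0r v0 andbT; apply/eqP => vz; move: ev; rewrite vz => ev.
have : ae_eq leb setT (fun x => ((phi x - t) ^+ 2 * gibbs1 x)%:E) (cst 0%E).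
  apply/(ae_eq_integral_abs leb measurableT (measurable_int _ iv)).
  by apply: etrans ev; apply: eq_integral => x _; exact: (gee0_abs (g0 x)).
move=> [N [mN N0 sub]].
have hN : `]0, 1[%classic `\` [set x | phi x = t] `<=` N.
  move=> x [/=]; rewrite in_itv/= => /andP[x0 _] px; apply: sub => /= /(_ I)/= [] /eqP.
  rewrite mulf_eq0 sqrf_eq0 subr_eq0 => /orP[/eqP//|].
  rewrite /gibbs1 boltzmann_fin; last by rewrite ltey_eq potential_fin_num.
  by rewrite mulf_eq0 invr_eq0 gt_eqF ?expR_gt0// gt_eqF// Zpart_gt0.
have [z hz] : exists z, `]0, 1[%classic `\` [set z] `<=` `]0, 1[%classic `\` [set x | phi x = t].
  have [[z [z01 pz]]|nz] := pselect (exists z, 0 < z < 1 /\ phi z = t).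
    exists z => x [/= x01 xz]; split=> // px; apply: xz.
    move: z01 x01; rewrite in_itv/= => /andP[z0 _] /andP[x0 _].
    have [xz|zx|//] := ltgtP x z.
      by have := potential_lt hf (ltW x0) xz; rewrite (px : phi x = t) (pz : phi z = t) ltxx.
    by have := potential_lt hf (ltW z0) zx; rewrite (px : phi x = t) (pz : phi z = t) ltxx.
  exists 0 => x [/= x01 _]; split=> // px; apply: nz; exists x; split=> //.
have : (leb `]0%R, 1%R[%classic <= leb (N `|` [set z]))%E.
  apply: le_measure; rewrite ?inE//; first exact: measurableU.
  move=> x x01; have [->|/eqP xz] := eqVneq x z; [by right|left].
  by apply: hN; apply: hz.
rewrite measureU0//; last exact: lebesgue_measure_set1.
by rewrite N0 lebesgue_measure_itv/= lte01 oppr0 adde0 lee_fin ler10.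
Qed.

End gibbs_dimension_one.

(** * Moments of weighted sums under the product measure *)

Section gibbs_product.
Context {R : realType} (f : R -> \bar R) (hf : classF f) (t c : R) (t0 : 0 < t) (c0 : 0 < c)
  (hmean : (\int[@lebesgue_measure R]_x
       ((gibbs f c ([tuple x] : Rn R 1))%:E * f x) = t%:E)%E).
Local Notation phi := (fine \o f).
Local Notation leb := (@lebesgue_measure R).
Local Notation g1 := (gibbs1 f c).

Lemma Rsum_ge0 n (x : Rn R n) : (0 <= Rsum f x)%E.
Proof. by apply: sume_ge0 => i _; exact: potential_ge0. Qed.

Lemma Rsum_consRn n (x : R) (y : Rn R n) : Rsum f (consRn (x, y)) = (f x + Rsum f y)%E.
Proof.
rewrite /Rsum big_ord_recl; congr (_ + _)%E.
by apply: eq_bigr => i _; congr f; rewrite !(tnth_nth 0).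
Qed.

Lemma gibbs_consRn n (x : R) (y : Rn R n) :
  gibbs f c (consRn (x, y)) = g1 x * gibbs f c y.
Proof.
rewrite /gibbs /gibbs1 /boltzmann Rsum_consRn.
have -> : fine (expeR (- (c%:E * (f x + Rsum f y)))%E) =
    fine (expeR (- (c%:E * f x))%E) * fine (expeR (- (c%:E * Rsum f y))%E).
  case: (f x) (potential_ge0 hf x) => [r _||]; case: (Rsum f y) (Rsum_ge0 y) => [s _||] //=.
  - by rewrite -expRD mulrDr opprD.
  - by rewrite gt0_muley ?lte_fin//= mulr0.
  - by rewrite gt0_muley ?lte_fin//= mul0r.
  - by rewrite gt0_muley ?lte_fin//= mul0r.
by rewrite exprS invfM mulrACA.
Qed.

Lemma gibbs_Rn0 (x : Rn R 0) : gibbs f c x = 1.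
Proof.
by rewrite /gibbs /Rsum big_ord0 mule0 oppe0 expeR0 expr0 divr1.
Qed.

Lemma gibbs_ge0 n (x : Rn R n) : 0 <= gibbs f c x.
Proof.
by rewrite divr_ge0 ?fine_ge0 ?expeR_ge0 ?exprn_ge0// ltW// (Zpart_gt0 hf t0 c0 hmean).
Qed.

Lemma gibbs_prod n (x : Rn R n) : gibbs f c x = \prod_(i < n) g1 (tnth x i).
Proof.
elim: n x => [x|n ih x]; first by rewrite gibbs_Rn0 big_ord0.
have -> : x = consRn (thead x, [tuple of behead x]) by exact: tuple_eta.
rewrite gibbs_consRn ih big_ord_recl; congr (_ * _).
by apply: eq_bigr => i _; congr (gibbs1 f c); rewrite !(tnth_nth 0).
Qed.

Lemma measurable_gibbs n : measurable_fun setT (@gibbs R f c n).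
Proof.
rewrite (_ : @gibbs R f c n = fun x : Rn R n => \prod_(i < n) g1 (tnth x i)); last first.
  by apply/funext => x; rewrite gibbs_prod.
apply: measurable_prod => i _.
by apply: measurableT_comp; [exact: measurable_gibbs1|exact: measurable_tnth].
Qed.

(** General weights cover block indicators, their rearrangements by a permutation, and the sums
    [u + v] needed for polarisation. *)
Definition wsum n (u : 'I_n -> R) (x : Rn R n) : R :=
  \sum_(i < n) u i * (phi (tnth x i) - t).

Lemma measurable_wsum n (u : 'I_n -> R) : measurable_fun setT (wsum u).
Proof.
apply: measurable_sum => i; apply: measurable_funM => //; apply: measurable_funB => //.
by apply: measurableT_comp; [exact: measurable_fine_potential|exact: measurable_tnth].
Qed.

Lemma wsum_consRn n (u : 'I_n.+1 -> R) (x : R) (y : Rn R n) :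
  wsum u (consRn (x, y)) = u ord0 * (phi x - t) + wsum (u \o lift ord0) y.
Proof.
rewrite /wsum big_ord_recl; congr (_ + _).
by apply: eq_bigr => i _; congr (_ * (phi _ - _)); rewrite !(tnth_nth 0).
Qed.

Lemma has_integral_Rn0 (F : Rn R 0 -> R) : has_integral (lebesgue_Rn 0) F (F [tuple]).
Proof.
have -> : F = cst (F [tuple]) by apply/funext => x; rewrite (tuple0 x).
have mF : measurable_fun setT (EFin \o (cst (F [tuple]) : Rn R 0 -> R)).
  by apply/measurable_EFinP; exact: (@measurable_cst _ _ (Rn R 0) R).
have e G : measurable_fun setT G -> (\int[lebesgue_Rn 0]_x G x = G [tuple])%E.
  by move=> mG; rewrite integral_dirac// diracT mul1e.
split; last by rewrite e.
by apply/integrableP; split=> //; rewrite e ?ltry//; exact: measurableT_comp.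
Qed.

Lemma gibbs_moment_consRn n (i j : nat) (F : Rn R n -> R) a b :
  has_integral leb (fun x => (phi x - t) ^+ i * g1 x) a ->
  has_integral (lebesgue_Rn n) (fun y => F y ^+ j * gibbs f c y) b ->
  has_integral (leb \x lebesgue_Rn n)%E
    (fun z => (phi z.1 - t) ^+ i * F z.2 ^+ j * (g1 z.1 * gibbs f c z.2)) (a * b).
Proof.
move=> ha hb; apply: has_integral_ext (has_integralM ha hb) => z /=.
by rewrite mulrACA.
Qed.

(** Induction on [n], splitting off one independent centred coordinate and expanding the powers. The
    third moment is carried along for integrability alone: in the fourth power it is multiplied by a
    zero mean. *)
Lemma wsum_moments : exists s K : R, 0 < s /\ forall n (u : 'I_n -> R),
  let q := \sum_(i < n) u i ^+ 2 in
  [/\ has_integral (lebesgue_Rn n) (@gibbs R f c n) 1,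
      has_integral (lebesgue_Rn n) (fun x => wsum u x * gibbs f c x) 0,
      has_integral (lebesgue_Rn n) (fun x => wsum u x ^+ 2 * gibbs f c x) (s * q),
      exists e, has_integral (lebesgue_Rn n) (fun x => wsum u x ^+ 3 * gibbs f c x) e &
      exists2 e, has_integral (lebesgue_Rn n) (fun x => wsum u x ^+ 4 * gibbs f c x) e
        & e <= K * q ^+ 2].
Proof.
have [m2 h2] := gibbs1_moment hf t0 c0 hmean (isT : (2 <= 4)%N).
have [m3 h3] := gibbs1_moment hf t0 c0 hmean (isT : (3 <= 4)%N).
have [m4 h4] := gibbs1_moment hf t0 c0 hmean (isT : (4 <= 4)%N).
have h1 : has_integral leb (fun x => (phi x - t) ^+ 1 * g1 x) 0 := gibbs1_mean hf t0 c0 hmean.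
have h0 : has_integral leb (fun x => (phi x - t) ^+ 0 * g1 x) 1.
  by apply: has_integral_ext (has_integral_gibbs1 hf t0 c0 hmean) => x; rewrite expr0 mul1r.
have m20 := gibbs1_variance_gt0 hf t0 c0 hmean h2.
(* With [a = u ord0 ^+ 2] the step adds [m4 a ^ 2 + 6 m2 ^ 2 a q'], and this [K] dominates both
   coefficients in [K (a + q') ^ 2]. *)
pose K := Num.max m4 (3 * m2 ^+ 2).
have Km4 : m4 <= K by rewrite le_max lexx.
have Km2 : 3 * m2 ^+ 2 <= K by rewrite le_max lexx orbT.
exists m2, K; split=> //; elim=> [|n ih] u q.
  have z (j : nat) : has_integral (lebesgue_Rn 0) (fun x => wsum u x ^+ j.+1 * gibbs f c x) 0.
    have := has_integral_Rn0 (fun x => wsum u x ^+ j.+1 * gibbs f c x).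
    by rewrite {2}/wsum big_ord0 expr0n mul0r.
  rewrite /q big_ord0 mulr0 expr0n mulr0; split.
  - by have := has_integral_Rn0 (@gibbs R f c 0); rewrite gibbs_Rn0.
  - exact: (z 0).
  - exact: z.
  - by exists 0; exact: z.
  - by exists 0; first exact: z.
have [k0 k1 k2 [e3 k3] [e4 k4 e4K]] := ih (u \o lift ord0).
set w := wsum (u \o lift ord0) in k1 k2 k3 k4.
set q' := \sum_(i < n) _ in k2 e4K.
have k1' : has_integral (lebesgue_Rn n) (fun y => w y ^+ 1 * gibbs f c y) 0 := k1.
have k0' : has_integral (lebesgue_Rn n) (fun y => w y ^+ 0 * gibbs f c y) 1.
  by apply: has_integral_ext k0 => y; rewrite expr0 mul1r.
have qE : q = u ord0 ^+ 2 + q' by rewrite /q big_ord_recl.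
have q'0 : 0 <= q' by apply: sumr_ge0 => i _; exact: sqr_ge0.
have red j v : has_integral (leb \x lebesgue_Rn n)%E
      (fun z => (u ord0 * (phi z.1 - t) + w z.2) ^+ j * (g1 z.1 * gibbs f c z.2)) v ->
    has_integral (lebesgue_Rn n.+1) (fun x => wsum u x ^+ j * gibbs f c x) v.
  move=> h; apply: has_integral_consRn.
    apply: measurable_funM; last exact: measurable_gibbs.
    by apply: measurable_funX; exact: measurable_wsum.
  by apply: has_integral_ext h => -[x y] /=; rewrite wsum_consRn gibbs_consRn.
have mom := gibbs_moment_consRn.
split.
- apply: has_integral_consRn; first exact: measurable_gibbs.
  rewrite -(mulr1 1); apply: has_integral_ext (mom _ _ _ _ _ _ h0 k0') => -[x y] /=.
  by rewrite gibbs_consRn !expr0 !mul1r.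
- apply: (red 1); have := has_integralD (has_integralZ (u ord0) (mom _ _ _ _ _ _ h1 k0')) (mom _ _ _ _ _ _ h0 k1').
  rewrite mul0r !mulr0 addr0; apply: has_integral_ext => z /=; ring.
- apply: red; have := has_integralD (has_integralD (has_integralZ (u ord0 ^+ 2) (mom _ _ _ _ _ _ h2 k0'))
    (has_integralZ (2 * u ord0) (mom _ _ _ _ _ _ h1 k1'))) (mom _ _ _ _ _ _ h0 k2).
  rewrite (_ : _ + _ + _ = m2 * q); last by rewrite qE; ring.
  apply: has_integral_ext => z /=; ring.
- eexists; apply: red; have := has_integralD (has_integralD (has_integralD
     (has_integralZ (u ord0 ^+ 3) (mom _ _ _ _ _ _ h3 k0'))
     (has_integralZ (3 * u ord0 ^+ 2) (mom _ _ _ _ _ _ h2 k1')))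
     (has_integralZ (3 * u ord0) (mom _ _ _ _ _ _ h1 k2))) (mom _ _ _ _ _ _ h0 k3).
  apply: has_integral_ext => z /=; ring.
- exists (u ord0 ^+ 4 * m4 + 6 * u ord0 ^+ 2 * (m2 * (m2 * q')) + e4).
    apply: red; have := has_integralD (has_integralD (has_integralD (has_integralD
     (has_integralZ (u ord0 ^+ 4) (mom _ _ _ _ _ _ h4 k0'))
     (has_integralZ (4 * u ord0 ^+ 3) (mom _ _ _ _ _ _ h3 k1')))
     (has_integralZ (6 * u ord0 ^+ 2) (mom _ _ _ _ _ _ h2 k2)))
     (has_integralZ (4 * u ord0) (mom _ _ _ _ _ _ h1 k3))) (mom _ _ _ _ _ _ h0 k4).
    rewrite (_ : _ + _ + _ + _ + _ =
      u ord0 ^+ 4 * m4 + 6 * u ord0 ^+ 2 * (m2 * (m2 * q')) + e4); last by ring.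
    apply: has_integral_ext => z /=; ring.
  rewrite qE; set a := u ord0 ^+ 2.
  have a0 : 0 <= a by exact: sqr_ge0.
  have -> : u ord0 ^+ 4 = a ^+ 2 by rewrite /a -exprM.
  have H1 : a ^+ 2 * m4 <= a ^+ 2 * K by rewrite ler_wpM2l ?sqr_ge0.
  have H2 : 2 * (a * q') * (3 * m2 ^+ 2) <= 2 * (a * q') * K.
    by apply: ler_wpM2l Km2; apply: mulr_ge0 => //; exact: mulr_ge0.
  have : K * (a + q') ^+ 2 = a ^+ 2 * K + 2 * (a * q') * K + K * q' ^+ 2 by ring.
  move=> ->; move: H1 H2 e4K; lra.
Qed.

End gibbs_product.

(** * A bounded substitute for the product of two block sums *)

Section truncated_correlation.
Context {R : realType}.

(* A truncation of [- a b] whose double sum over [m] variables adding up to zero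
   is still nonnegative: a variable exceeding [Lam] in absolute value contributes
   [m Lam^2] to each row, the other terms of the row at least [- Lam^2] each. *)
Definition truncated_corr (m : nat) (Lam a b : R) : R :=
  if Lam < `|b| then m%:R * Lam ^+ 2 else if Lam < `|a| then 0 else - (a * b).

Lemma truncated_corr_bounds m Lam a b : (0 < m)%N -> 0 < Lam ->
  - Lam ^+ 2 <= truncated_corr m Lam a b <= m%:R * Lam ^+ 2.
Proof.
move=> m0 L0; have m1 : 1 <= m%:R :> R by rewrite ler1n.
have L2 : 0 <= Lam ^+ 2 by exact: sqr_ge0.
have mL : Lam ^+ 2 <= m%:R * Lam ^+ 2 by rewrite ler_peMl.
rewrite /truncated_corr; case: ltP => [_|hb]; first by apply/andP; split; lra.
case: ltP => [_|ha]; first by apply/andP; split; lra.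
have : `|a * b| <= Lam ^+ 2 by rewrite normrM expr2 ler_pM.
by rewrite ler_norml => /andP[h1 h2]; apply/andP; split; lra.
Qed.

(** A variable [x] exceeding [Lam] satisfies [Lam ^ 2 <= x ^ 2 <= x ^ 4 / Lam ^ 2], so fourth powers
    absorb the value [m Lam ^ 2] as well as the lost product, which is at most
    [(a ^ 2 + b ^ 2) / 2]. *)
Lemma truncated_corr_le m Lam a b : 0 < Lam ->
  truncated_corr m Lam a b <=
    - (a * b) + (m.+1)%:R * (b ^+ 4 / Lam ^+ 2) + a ^+ 4 / Lam ^+ 2.
Proof.
move=> L0; have L2 : 0 < Lam ^+ 2 by rewrite exprn_gt0.
have big x : Lam < `|x| -> Lam ^+ 2 <= x ^+ 2 /\ x ^+ 2 <= x ^+ 4 / Lam ^+ 2.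
  move=> Lx; have h : Lam ^+ 2 <= x ^+ 2.
    by rewrite -(real_normK (num_real x)) lerXn2r ?nnegrE ?(ltW L0) ?(ltW Lx).
  have x4 : x ^+ 4 = x ^+ 2 * x ^+ 2 by rewrite -exprD.
  split=> //; rewrite ler_pdivlMr// x4.
  by rewrite ler_wpM2l// sqr_ge0.
have pos x : 0 <= x ^+ 4 / Lam ^+ 2.
  by rewrite divr_ge0 ?(ltW L2)// (_ : 4%N = (2 * 2)%N)// exprM sqr_ge0.
have small x : `|x| <= Lam -> x ^+ 2 <= Lam ^+ 2.
  by move=> xL; rewrite -(real_normK (num_real x)) lerXn2r ?nnegrE ?(ltW L0).
have amgm : a * b <= (a ^+ 2 + b ^+ 2) / 2.
  by have := sqr_ge0 (a - b); rewrite sqrrB; lra.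
have pa := pos a; have pb := pos b.
have mb : 0 <= m%:R * (b ^+ 4 / Lam ^+ 2) by rewrite mulr_ge0.
rewrite -natr1 mulrDl mul1r /truncated_corr; case: ltP => [hb|hb].
  have [b1 b2] := big _ hb.
  have : m%:R * Lam ^+ 2 <= m%:R * (b ^+ 4 / Lam ^+ 2) by rewrite ler_wpM2l//; lra.
  have [ha|ha] := leP `|a| Lam; first by have := small _ ha; lra.
  by have [] := big _ ha; lra.
case: ltP => [ha|ha]; last by lra.
by have [] := big _ ha; have := small _ hb; lra.
Qed.

Lemma sum_truncated_corr_ge0 m Lam (S : 'I_m -> R) : 0 < Lam -> \sum_i S i = 0 ->
  0 <= \sum_i \sum_j truncated_corr m Lam (S i) (S j).
Proof.
case: m S => [|m] S L0 S0; first by rewrite big_ord0.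
have [/existsP[j0 hj0]|/existsPn small] := boolP [exists j, Lam < `|S j|].
  apply: sumr_ge0 => i _; rewrite (bigD1 j0)//= {1}/truncated_corr hj0.
  have : \sum_(j < m.+1 | j != j0) - Lam ^+ 2 <=
      \sum_(j < m.+1 | j != j0) truncated_corr m.+1 Lam (S i) (S j).
    by apply: ler_sum => j _; have /andP[] := @truncated_corr_bounds m.+1 Lam (S i) (S j) isT L0.
  rewrite sumr_const (_ : #|_| = m); last by rewrite cardC1 card_ord.
  rewrite -mulr_natl -natr1 => h; have := sqr_ge0 Lam; move: h; lra.
(* No variable is truncated: the double sum is minus the square of the total, which is zero. *)
rewrite (eq_bigr (fun i => \sum_j - (S i * S j))); last first.
  move=> i _; apply: eq_bigr => j _; rewrite /truncated_corr.
  by rewrite (negbTE (small j)) (negbTE (small i)).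
rewrite (eq_bigr (fun i => 0)); first by rewrite big1.
by move=> i _; rewrite sumrN -mulr_sumr S0 mulr0 oppr0.
Qed.

Lemma measurable_truncated_corr d (T : measurableType d) m Lam (X Y : T -> R) :
  measurable_fun setT X -> measurable_fun setT Y ->
  measurable_fun setT (fun x => truncated_corr m Lam (X x) (Y x)).
Proof.
move=> mX mY; apply: measurable_fun_ifT => //.
  apply: measurable_fun_ltr => //; exact: measurableT_comp.
apply: measurable_fun_ifT => //.
  apply: measurable_fun_ltr => //; exact: measurableT_comp.
by apply: measurableT_comp; [exact: oppr_measurable|exact: measurable_funM].
Qed.

End truncated_correlation.

(** Pointwise, [G u <= G v + M |u - v|]. *)
Lemma integral_dTV_le (R : realType) k (u v : Rn R k -> R) (G : Rn R k -> R) (M d w : R) :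
  measurable_fun setT u -> measurable_fun setT v ->
  (forall x, 0 <= u x) -> (forall x, 0 <= v x) ->
  measurable_fun setT G -> (forall x, 0 <= G x <= M) ->
  has_integral (lebesgue_Rn k) (fun x => G x * v x) w -> (dTV u v <= d%:E)%E ->
  (\int[lebesgue_Rn k]_x ((G x)%:E * (u x)%:E) <= (w + M * d)%:E)%E.
Proof.
move=> mu mv u0 v0 mG GM [iw ew] le_d.
have M0 : 0 <= M.
  by have := GM (nseq_tuple k 0); move=> /andP[]; exact: le_trans.
have mGu : measurable_fun setT (fun x => G x * u x) by exact: measurable_funM.
have mGv : measurable_fun setT (fun x => G x * v x) by exact: measurable_funM.
have muv : measurable_fun setT (fun x => `|u x - v x|).
  by apply: measurableT_comp => //; exact: measurable_funB.
apply: (@le_trans _ _ (\int[lebesgue_Rn k]_x ((G x * v x)%:E + M%:E * `|u x - v x|%:E))%E).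
  apply: ge0_le_integral => //.
  - by move=> x _; rewrite mule_ge0// lee_fin; have /andP[] := GM x.
  - exact/measurable_EFinP.
  - apply: emeasurable_funD; first exact/measurable_EFinP.
    by apply: measurable_funeM; exact/measurable_EFinP.
  move=> x _; rewrite -!EFinM -EFinD lee_fin -lerBlDl -mulrBr.
  have /andP[G0 GMx] := GM x.
  by apply: (le_trans (ler_wpM2l G0 (ler_norm _))); rewrite ler_wpM2r.
rewrite ge0_integralD//; last 4 first.
- by move=> x _; rewrite lee_fin mulr_ge0//; have /andP[] := GM x.
- exact/measurable_EFinP.
- by move=> x _; rewrite mule_ge0// lee_fin.
- by apply: measurable_funeM; exact/measurable_EFinP.
rewrite ew ge0_integralZl_EFin//; last exact/measurable_EFinP.
by rewrite EFinD leeD2l// EFinM lee_wpmul2l// lee_fin.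
Qed.

Lemma perm_to_front n k (D : {set 'I_n}) : (#|D| <= k)%N ->
  exists s : {perm 'I_n}, forall i : 'I_n, (k <= i)%N -> s i \notin D.
Proof.
move=> Dk; pose e := enum D ++ enum (~: D)%SET.
have ue : uniq e.
  rewrite cat_uniq !enum_uniq andbT/=; apply/hasPn => x.
  by rewrite !mem_enum finset.in_setC.
have se : size e = n by rewrite size_cat -!cardE cardsC card_ord.
have inj : injective (fun i : 'I_n => nth i e i).
  move=> i j; rewrite (set_nth_default i j) ?se// => /eqP.
  by rewrite nth_uniq ?se// => /eqP/val_inj.
exists (perm inj) => i ki; rewrite permE nth_cat -cardE ltnNge (leq_trans Dk ki)/=.
set x := nth _ _ _; have : x \in enum (~: D)%SET.
  by apply: mem_nth; rewrite -cardE ltn_subLR ?(leq_trans Dk ki)// cardsC card_ord.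
by rewrite mem_enum finset.in_setC.
Qed.

(** * From the level set to the marginal density *)

Section transport.
Context {R : realType} (f : R -> \bar R) (hf : classF f) (t : R) (t0 : 0 < t).
Context (n k : nat) (n2 : (2 <= n)%N) (kn : (k <= n)%N) (A : R -> Rn R n -> R)
  (hA : is_jacobian f t A) (p : Rn R k -> R) (hp : marginal_density f t A p).
Local Notation h := (microcanonical f t A).
Local Notation wide := (widen_ord kn).

Lemma tnth_first_coords (x : Rn R n) l : tnth (@first_coords R n k x) l = tnth x (wide l).
Proof. by rewrite tnth_mktuple (tnth_nth 0). Qed.

Lemma measurable_first_coords : measurable_fun setT (@first_coords R n k).
Proof.
apply/measurable_fun_tnthP => i.
rewrite (_ : _ \o _ = fun x : Rn R n => tnth x (wide i)); first exact: measurable_tnth.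
by apply/funext => x /=; rewrite tnth_first_coords.
Qed.

Lemma integral_marginal (G : Rn R k -> \bar R) :
  measurable_fun setT G -> (forall x, 0 <= G x)%E ->
  (\int[lebesgue_Rn k]_x (G x * (p x)%:E) =
   \int[surface n]_(x in Slevel f t) (G (@first_coords R n k x) * (h x)%:E))%E.
Proof.
move=> mG G0; have [[mp p0 _] e] := hp.
apply: ge0_integral_density => //.
- exact: measurable_Slevel.
- exact: measurable_first_coords.
- exact: measurable_microcanonical.
- exact: microcanonical_ge0.
Qed.

(** Read off from the total mass of [p], with no separate study of the normalising integral in
    [microcanonical]. *)
Lemma integral_microcanonical1 :
  (\int[surface n]_(x in Slevel f t) (h x)%:E = 1)%E.
Proof.
have [[_ _ p1] e] := hp; have := e setT measurableT.
by rewrite p1 preimage_setT setIT.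
Qed.

Lemma sum_widen (F : 'I_n -> R) : (forall i : 'I_n, (k <= i)%N -> F i = 0) ->
  \sum_(i < n) F i = \sum_(l < k) F (wide l).
Proof.
move=> F0; rewrite -(big_ord_narrow kn) [RHS]big_mkcond/=; apply: eq_bigr => i _.
by case: ltnP => // /F0.
Qed.

(* By exchangeability the coordinates carrying the weights may be assumed to
   be among the first [k]. *)
Lemma microcanonical_wsum_pair (w1 w2 : 'I_n -> R) (D : {set 'I_n}) (G : R -> R -> R) :
  (#|D| <= k)%N -> (forall i, i \notin D -> w1 i = 0 /\ w2 i = 0) ->
  (forall d (T : measurableType d) (X Y : T -> R), measurable_fun setT X ->
     measurable_fun setT Y -> measurable_fun setT (fun x => G (X x) (Y x))) ->
  (forall a b, 0 <= G a b) ->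
  exists u v : 'I_k -> R,
    [/\ \sum_(l < k) u l ^+ 2 = \sum_(i < n) w1 i ^+ 2,
        \sum_(l < k) v l ^+ 2 = \sum_(i < n) w2 i ^+ 2,
        \sum_(l < k) u l * v l = \sum_(i < n) w1 i * w2 i &
        (\int[surface n]_(x in Slevel f t)
            ((G (wsum f t w1 x) (wsum f t w2 x))%:E * (h x)%:E) =
         \int[lebesgue_Rn k]_x ((G (wsum f t u x) (wsum f t v x))%:E * (p x)%:E))%E].
Proof.
move=> Dk wD mG G0; have [s hs] := perm_to_front Dk.
have w1s (i : 'I_n) : (k <= i)%N -> w1 (s i) = 0 by move=> /hs /wD[].
have w2s (i : 'I_n) : (k <= i)%N -> w2 (s i) = 0 by move=> /hs /wD[].
have sumS (F : 'I_n -> R) : (forall i : 'I_n, (k <= i)%N -> F (s i) = 0) ->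
    \sum_(l < k) F (s (wide l)) = \sum_(i < n) F i.
  by move=> F0; rewrite [RHS](reindex_inj (@perm_inj _ s)) [RHS]sum_widen.
(* After the permutation the weights vanish from position [k] on, so the weighted sum factors
   through the first [k] coordinates. *)
have ws (w : 'I_n -> R) : (forall i : 'I_n, (k <= i)%N -> w (s i) = 0) -> forall x : Rn R n,
    wsum f t w x = wsum f t (fun l => w (s (wide l))) (@first_coords R n k (perm_Rn s x)).
  move=> w0 x; rewrite /wsum -(sumS (fun i => w i * _)); last first.
    by move=> i /w0 ->; rewrite mul0r.
  by apply: eq_bigr => l _; rewrite tnth_first_coords tnth_perm_Rn.
exists (fun l => w1 (s (wide l))), (fun l => w2 (s (wide l))); split.
- by apply: (sumS (fun i => w1 i ^+ 2)) => i /w1s ->; rewrite expr0n.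
- by apply: (sumS (fun i => w2 i ^+ 2)) => i /w2s ->; rewrite expr0n.
- by apply: (sumS (fun i => w1 i * w2 i)) => i /w1s ->; rewrite mul0r.
pose H (y : Rn R k) := (G (wsum f t (fun l => w1 (s (wide l))) y)
   (wsum f t (fun l => w2 (s (wide l))) y))%:E.
have mH : measurable_fun setT H.
  by apply/measurable_EFinP; apply: mG; exact: measurable_wsum.
rewrite (integral_marginal mH) => [|y]; last by rewrite lee_fin.
rewrite -(@integral_microcanonical_perm _ _ hf _ t0 _ n2 _ hA s (H \o @first_coords R n k)).
- by apply: eq_integral => x _; rewrite /H /= -!ws.
- by apply: measurableT_comp => //; exact: measurable_first_coords.
- by move=> x; rewrite lee_fin.
Qed.

End transport.

(** * Combinatorics of the blocks *)

Section blocks.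
Context {R : realType}.

Lemma card_block n b (j : nat) : (0 < b)%N -> (#|[set l : 'I_n | (l %/ b)%N == j]%SET| <= b)%N.
Proof.
move=> b0; pose g (l : 'I_n) : 'I_b := Ordinal (ltn_pmod l b0).
rewrite -(@card_in_imset _ _ g) => [|x y]; first by rewrite (leq_trans (max_card _))// card_ord.
rewrite !finset.inE => /eqP xj /eqP yj [xy]; apply/val_inj => /=.
by rewrite (divn_eq x b) (divn_eq y b) xj yj xy.
Qed.

(** With [j < (n %/ b).+1] the blocks exhaust the indices. The last one is shorter, and empty when
    [b] divides [n], so sizes are only bounded above. *)
Definition block n b (j : nat) (l : 'I_n) : R := ((l %/ b)%N == j)%:R.

Lemma sum_block_sqr n b j : (0 < b)%N -> \sum_(l < n) block b j l ^+ 2 <= b%:R :> R.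
Proof.
move=> b0; rewrite (eq_bigr (fun l : 'I_n => (l \in [set l : 'I_n | (l %/ b)%N == j]%SET)%:R)); last first.
  by move=> l _; rewrite /block finset.inE; case: eqP; rewrite ?expr1n ?expr0n.
rewrite -natr_sum ler_nat (leq_trans _ (card_block n j b0))// -sum1_card [leqRHS]big_mkcond/=.
by apply: leq_sum => l _; case: ifP.
Qed.

Lemma sum_blocks n b (F : 'I_n -> R) : (0 < b)%N ->
  \sum_(j < (n %/ b).+1) \sum_(l < n) block b j l * F l = \sum_(l < n) F l.
Proof.
move=> b0; rewrite exchange_big/=; apply: eq_bigr => l _.
have lj : (l %/ b < (n %/ b).+1)%N by rewrite ltnS leq_div2r// ltnW.
rewrite (bigD1 (Ordinal lj))//= /block eqxx mul1r big1 ?addr0// => j jl.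
case: eqP => [e|]; last by rewrite mul0r.
by move/eqP: jl; case; apply/val_inj; rewrite /= e.
Qed.

(** The squared norm of the all-ones weight, expanded over blocks: times [s], it is the variance of
    the full sum under the product measure. *)
Lemma sum_block_pairs n b : (0 < b)%N ->
  \sum_(i < (n %/ b).+1) \sum_(j < (n %/ b).+1) \sum_(l < n) block b i l * block b j l =
  n%:R :> R.
Proof.
move=> b0; rewrite (eq_bigr (fun i : 'I__ => \sum_(l < n) block b i l * 1)); last first.
  move=> i _; rewrite exchange_big/=; apply: eq_bigr => l _; rewrite -mulr_sumr; congr (_ * _).
  have delta (F : 'I_n -> R) : \sum_(l' < n) F l' * (l' == l)%:R = F l.
    by rewrite (bigD1 l)//= eqxx mulr1 big1 ?addr0// => l' /negbTE ->; rewrite mulr0.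
  rewrite -[RHS](delta (fun=> 1)) -[RHS](sum_blocks (fun l' => 1 * (l' == l)%:R) b0); apply: eq_bigr => j _.
  by rewrite -[LHS]delta; apply: eq_bigr => l' _; rewrite mul1r.
by rewrite sum_blocks// sumr_const card_ord.
Qed.

End blocks.

(** * The inequality relating [n], the block size and [d_TV] *)

Section block_inequality.
Context {R : realType} (f : R -> \bar R) (hf : classF f) (t c : R) (t0 : 0 < t) (c0 : 0 < c)
  (hmean : (\int[@lebesgue_measure R]_x
       ((gibbs f c ([tuple x] : Rn R 1))%:E * f x) = t%:E)%E).
Local Notation phi := (fine \o f).

Lemma wsumD n (u v : 'I_n -> R) (x : Rn R n) :
  wsum f t (fun l => u l + v l) x = wsum f t u x + wsum f t v x.
Proof. by rewrite /wsum -big_split; apply: eq_bigr => l _; rewrite mulrDl. Qed.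

(** The shift by [m Lam ^ 2] puts the test function into [[0, 2 m Lam ^ 2]]. Its mean is bounded by
    integrating [truncated_corr_le]: the product contributes [- s] times the overlap of the weights,
    and [m + 2] counts the fourth moments. *)
Lemma gibbs_truncated_corr : exists s K : R, 0 < s /\ 0 <= K /\
  forall (m k : nat) (Lam q : R) (u v : 'I_k -> R), (0 < m)%N -> 0 < Lam ->
    \sum_(l < k) u l ^+ 2 <= q -> \sum_(l < k) v l ^+ 2 <= q ->
    exists w, has_integral (lebesgue_Rn k)
      (fun x => (truncated_corr m Lam (wsum f t u x) (wsum f t v x) + m%:R * Lam ^+ 2) *
         gibbs f c x) w /\
      w <= m%:R * Lam ^+ 2 - s * (\sum_(l < k) u l * v l) + m.+2%:R * (K * q ^+ 2 / Lam ^+ 2).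
Proof.
have [s [K' [s0 mom]]] := wsum_moments hf t0 c0 hmean.
exists s, `|K'|; split=> //; split=> // m k Lam q u v m0 L0 uq vq.
set C := m%:R * Lam ^+ 2.
have [g1 _ u2 _ [u4 hu4 leu4]] := mom k u.
have [_ _ v2 _ [v4 hv4 lev4]] := mom k v.
have [_ _ uv2 _ _] := mom k (fun l => u l + v l).
have q4 (z : 'I_k -> R) e : \sum_(l < k) z l ^+ 2 <= q ->
    e <= K' * (\sum_(l < k) z l ^+ 2) ^+ 2 -> e <= `|K'| * q ^+ 2.
  move=> zq /le_trans; apply.
  have z0 : 0 <= \sum_(l < k) z l ^+ 2 by apply: sumr_ge0 => l _; exact: sqr_ge0.
  apply: (@le_trans _ _ (`|K'| * (\sum_(l < k) z l ^+ 2) ^+ 2)).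
    by rewrite ler_wpM2r ?sqr_ge0// ler_norm.
  by rewrite ler_wpM2l// lerXn2r ?nnegrE// (le_trans z0).
have {}leu4 := q4 _ _ uq leu4; have {}lev4 := q4 _ _ vq lev4.
have gge0 (x : Rn R k) : 0 <= gibbs f c x by exact: (gibbs_ge0 hf t0 c0 hmean).
have bounds := truncated_corr_bounds _ _ m0 L0.
pose T (x : Rn R k) := truncated_corr m Lam (wsum f t u x) (wsum f t v x).
have mT : measurable_fun setT T by apply: measurable_truncated_corr; exact: measurable_wsum.
have mC : Lam ^+ 2 <= C by rewrite /C ler_peMl ?sqr_ge0// ler1n.
have [w hw] : exists w, has_integral (lebesgue_Rn k) (fun x => (T x + C) * gibbs f c x) w.
  apply: (has_integral_dominated _ _ (has_integralZ (2 * C) g1)).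
    apply: measurable_funM; first exact: measurable_funD.
    exact: (measurable_gibbs hf c0).
  move=> x; rewrite normrM (ger0_norm (gge0 x)) ler_wpM2r// ger0_norm.
    by have /andP[_] := bounds (wsum f t u x) (wsum f t v x); rewrite /T -/C; lra.
  by have /andP[+ _] := bounds (wsum f t u x) (wsum f t v x); rewrite /T; lra.
exists w; split=> //.
(* Polarisation: the mixed moment comes from the second moments of [u + v], [u] and [v]. *)
have huv : has_integral (lebesgue_Rn k) (fun x => wsum f t u x * wsum f t v x * gibbs f c x)
    (s * \sum_(l < k) u l * v l).
  have := has_integralZ (1 / 2) (has_integralD uv2 (has_integralZ (- 1) (has_integralD u2 v2))).
  have -> : 1 / 2 * (s * (\sum_(i < k) (u i + v i) ^+ 2) +
      -1 * (s * (\sum_(i < k) u i ^+ 2) + s * (\sum_(i < k) v i ^+ 2))) =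
      s * \sum_(l < k) u l * v l.
    have -> : \sum_(i < k) (u i + v i) ^+ 2 = \sum_(i < k) u i ^+ 2 +
        2 * (\sum_(i < k) u i * v i) + \sum_(i < k) v i ^+ 2.
      by rewrite mulr_sumr -!big_split; apply: eq_bigr => i _ /=; ring.
    by field.
  by apply: has_integral_ext => x; rewrite wsumD; field.
have hU := has_integralD (has_integralD (has_integralD (has_integralZ C g1) (has_integralZ (- 1) huv))
   (has_integralZ (m.+1%:R / Lam ^+ 2) hv4)) (has_integralZ (Lam ^+ 2)^-1 hu4).
apply: (le_trans (has_integral_le hw hU _)).
  move=> x; rewrite [leRHS](_ : _ = (- (wsum f t u x * wsum f t v x) +
      (m.+1)%:R * (wsum f t v x ^+ 4 / Lam ^+ 2) + wsum f t u x ^+ 4 / Lam ^+ 2 + C) *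
      gibbs f c x); last by ring.
  by rewrite ler_wpM2r// lerD2r truncated_corr_le.
have L2 : 0 < Lam ^+ 2 by rewrite exprn_gt0.
have L2V : 0 <= (Lam ^+ 2)^-1 by rewrite invr_ge0 ltW.
have a1 : m.+1%:R / Lam ^+ 2 * v4 <= m.+1%:R / Lam ^+ 2 * (`|K'| * q ^+ 2).
  by apply: ler_wpM2l lev4; rewrite mulr_ge0.
have a2 : (Lam ^+ 2)^-1 * u4 <= (Lam ^+ 2)^-1 * (`|K'| * q ^+ 2) by exact: ler_wpM2l leu4.
have -> : m.+2%:R * (`|K'| * q ^+ 2 / Lam ^+ 2) = m.+1%:R / Lam ^+ 2 * (`|K'| * q ^+ 2) +
    (Lam ^+ 2)^-1 * (`|K'| * q ^+ 2).
  by rewrite -[m.+2%:R]natr1; ring.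
rewrite mulr1; lra.
Qed.

(** The microcanonical mean of the double sum of shifted truncated products is estimated twice: from
    below by [m ^ 2 C], and from above pair by pair through the product measure. The [C] cancel, and
    the overlaps add up to [n]. *)
Lemma block_inequality : exists s K : R, 0 < s /\ 0 <= K /\
  forall (n k : nat) (A : R -> Rn R n -> R) (p : Rn R k -> R) (d Lam : R),
  (2 <= k <= n)%N -> is_jacobian f t A -> marginal_density f t A p ->
  (dTV p (@gibbs R f c k) <= d%:E)%E -> 0 < Lam ->
  forall b m, b = (k./2)%N -> m = (n %/ b).+1 ->
  s * n%:R <= m%:R ^+ 2 * (m.+2%:R * (K * b%:R ^+ 2 / Lam ^+ 2) + 2 * (m%:R * Lam ^+ 2) * d).
Proof.
have [s [K [s0 [K0 H]]]] := gibbs_truncated_corr.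
exists s, K; split=> //; split=> // n k A p d Lam /andP[k2 kn] hA hp hd L0 b _ bE ->; pose m := (n %/ b).+1; rewrite -/m.
have n2 : (2 <= n)%N := leq_trans k2 kn.
have b0 : (0 < b)%N by rewrite bE half_gt0.
set C := m%:R * Lam ^+ 2.
have C0 : 0 <= C by rewrite mulr_ge0 ?sqr_ge0.
have bounds x y := truncated_corr_bounds (m := m) x y isT L0.
have mC : Lam ^+ 2 <= C by rewrite /C ler_peMl ?sqr_ge0// ler1n.
pose G a b := truncated_corr m Lam a b + C.
have G0 x y : 0 <= G x y by have /andP[] := bounds x y; rewrite /G; lra.
have G2 x y : G x y <= 2 * C by have /andP[] := bounds x y; rewrite /G -/C; lra.
have mG d' (T : measurableType d') (X Y : T -> R) : measurable_fun setT X ->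
     measurable_fun setT Y -> measurable_fun setT (fun x => G (X x) (Y x)).
  by move=> mX mY; apply: measurable_funD => //; exact: measurable_truncated_corr.
have [[mp p0 _] _] := hp.
pose h := microcanonical f t A.
pose W (j : 'I_m) (x : Rn R n) := wsum f t (block b j) x.
pose eps := m.+2%:R * (K * b%:R ^+ 2 / Lam ^+ 2) + 2 * C * d.
have pair (i j : 'I_m) :
  (\int[surface n]_(x in Slevel f t) ((G (W i x) (W j x))%:E * (h x)%:E) <=
   (C - s * (\sum_(l < n) block b i l * block b j l) + eps)%:E)%E.
  pose D := ([set l : 'I_n | (l %/ b)%N == i] :|: [set l : 'I_n | (l %/ b)%N == j])%SET.
  have Dk : (#|D| <= k)%N.
    rewrite (leq_trans (leq_card_setU _ _))// (leq_trans (leq_add (card_block _ _ b0) (card_block _ _ b0)))//.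
    by rewrite addnn bE -[leqRHS]odd_double_half leq_addl.
  have wD (l : 'I_n) : l \notin D -> block b i l = 0 :> R /\ block b j l = 0 :> R.
    by rewrite !finset.inE negb_or /block => /andP[/negbTE -> /negbTE ->].
  have [u [v [uE vE uvE ->]]] := microcanonical_wsum_pair hf t0 n2 kn hA hp Dk wD mG G0.
  have uq : \sum_(l < k) u l ^+ 2 <= b%:R by rewrite uE sum_block_sqr.
  have vq : \sum_(l < k) v l ^+ 2 <= b%:R by rewrite vE sum_block_sqr.
  have [w [hw lew]] := H m k Lam b%:R u v isT L0 uq vq.
  have mg := measurable_gibbs hf c0 (n := k).
  have g0 := gibbs_ge0 hf t0 c0 hmean (n := k).
  apply: (le_trans (integral_dTV_le (M := 2 * C) mp mg p0 g0 _ _ hw hd)).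
  - by apply: mG; exact: measurable_wsum.
  - by move=> x; rewrite G0 G2.
  by rewrite lee_fin -uvE /eps; move: lew; rewrite -/C; lra.
have mW j : measurable_fun setT (W j) by exact: measurable_wsum.
have h0 x : Slevel f t x -> 0 <= h x by exact: microcanonical_ge0.
have mh : measurable_fun (Slevel f t) (EFin \o h).
  by apply/measurable_EFinP; exact: measurable_microcanonical.
have mS : measurable (Slevel f t : set (Rn R n)) by exact: measurable_Slevel.
have mGh i j : measurable_fun (Slevel f t) (fun x => (G (W i x) (W j x))%:E * (h x)%:E)%E.
  apply: emeasurable_funM => //; apply/measurable_EFinP/measurable_funTS; exact: mG.
have Gh0 i j x : Slevel f t x -> (0 <= (G (W i x) (W j x))%:E * (h x)%:E)%E.
  by move=> Sx; rewrite mule_ge0// lee_fin// h0.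
(* On the level set the block sums add up to zero, so the double sum without the shifts is
   nonnegative. *)
have low : ((m%:R ^+ 2 * C)%:E <= \sum_(i < m) \sum_(j < m)
    \int[surface n]_(x in Slevel f t) ((G (W i x) (W j x))%:E * (h x)%:E))%E.
  have -> : (\sum_(i < m) \sum_(j < m)
    \int[surface n]_(x in Slevel f t) ((G (W i x) (W j x))%:E * (h x)%:E) =
    \int[surface n]_(x in Slevel f t) \sum_(i < m) \sum_(j < m) ((G (W i x) (W j x))%:E * (h x)%:E))%E.
    rewrite ge0_integral_sum//; last 2 first.
    - by move=> i; exact: emeasurable_sum.
    - by move=> i x Sx; apply: sume_ge0 => j _; exact: Gh0.
    by apply: eq_bigr => i _; rewrite ge0_integral_sum// => j x; exact: Gh0.
  rewrite -[leLHS]mule1 -(integral_microcanonical1 hp) -ge0_integralZl_EFin//; last first.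
    by rewrite mulr_ge0// sqr_ge0.
  apply: ge0_le_integral => //.
  - by move=> x Sx; rewrite mule_ge0// lee_fin ?h0// mulr_ge0// sqr_ge0.
  - exact: measurable_funeM.
  - by apply: emeasurable_sum => i; exact: emeasurable_sum.
  move=> x Sx; have -> : (\sum_(i < m) \sum_(j < m) ((G (W i x) (W j x))%:E * (h x)%:E) =
      ((\sum_(i < m) \sum_(j < m) G (W i x) (W j x)) * h x)%:E)%E.
    rewrite mulr_suml -sumEFin; apply: eq_bigr => i _.
    by rewrite mulr_suml -sumEFin.
  rewrite -EFinM lee_fin ler_wpM2r ?h0//.
  have W0 : \sum_(j < m) W j x = 0.
    rewrite /W /wsum sum_blocks// big_split/= (Slevel_sum hf Sx) sumr_const card_ord.
    by rewrite mulNrn mulr_natl subrr.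
  have := @sum_truncated_corr_ge0 R m Lam (fun j => W j x) L0 W0.
  have -> : \sum_(i < m) \sum_(j < m) G (W i x) (W j x) =
      \sum_(i < m) \sum_(j < m) truncated_corr m Lam (W i x) (W j x) + m%:R ^+ 2 * C.
    rewrite (eq_bigr (fun i => \sum_j truncated_corr m Lam (W i x) (W j x) + m%:R * C)).
      by rewrite big_split/= sumr_const card_ord -[m%:R * C *+ m]mulr_natl expr2 mulrA.
    by move=> i _; rewrite big_split/= sumr_const card_ord [m%:R * C]mulr_natl.
  lra.
have : ((m%:R ^+ 2 * C)%:E <= \sum_(i < m) \sum_(j < m)
    (C - s * (\sum_(l < n) block b i l * block b j l) + eps)%:E)%E.
  by apply: (le_trans low); apply: lee_sum => i _; apply: lee_sum => j _; exact: pair.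
under eq_bigr do rewrite sumEFin.
rewrite sumEFin lee_fin.
have -> : \sum_(i < m) \sum_(j < m) (C - s * (\sum_(l < n) block b i l * block b j l) + eps) =
    m%:R ^+ 2 * (C + eps) - s * n%:R.
  rewrite -(@sum_block_pairs R n b b0) -/m mulr_sumr.
  rewrite [X in X - _](_ : _ = \sum_(i < m) m%:R * (C + eps)); last first.
    by rewrite sumr_const card_ord -[RHS]mulr_natl expr2 mulrA.
  rewrite -sumrB; apply: eq_bigr => i _; rewrite mulr_sumr.
  rewrite [X in X - _](_ : _ = \sum_(j < m) (C + eps)); last first.
    by rewrite sumr_const card_ord mulr_natl.
  by rewrite -sumrB; apply: eq_bigr => j _; ring.
rewrite mulrDr /eps; lra.
Qed.

End block_inequality.

(** * Total variation is controlled by relative entropy *)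

Section pinsker.
Context {R : realType}.

(** From [ln y <= y - 1] at [y = b / a]. With [a] and [b] the roots of two densities, it bounds the
    Hellinger integrand by the entropy integrand up to a term of zero integral. *)
Lemma sqr_sub_le_ln (a b : R) : 0 < a -> 0 < b ->
  (a - b) ^+ 2 <= a ^+ 2 * ln (a ^+ 2 / b ^+ 2) + b ^+ 2 - a ^+ 2.
Proof.
move=> a0 b0; have ba0 : 0 < b / a by rewrite divr_gt0.
have -> : a ^+ 2 / b ^+ 2 = (b / a)^-1 ^+ 2.
  by rewrite invf_div expr_div_n.
rewrite lnXn ?invr_gt0// lnV ?posrE//.
have h : ln (b / a) <= b / a - 1.
  have := @le_ln1Dx R (b / a - 1); rewrite [1 + _]addrC subrK; apply.
  by rewrite ltrBrDr addNr.
have : a ^+ 2 * ln (b / a) <= a ^+ 2 * (b / a - 1) by rewrite ler_wpM2l ?sqr_ge0.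
have -> : a ^+ 2 * (b / a - 1) = a * b - a ^+ 2.
  by field; rewrite gt_eqF.
rewrite mulr2n; lra.
Qed.

(* [|u - v| = |sqrt u - sqrt v| (sqrt u + sqrt v)], followed by AM-GM. *)
Lemma dist_le_entropy (u v e : R) : 0 < u -> 0 < v -> 0 < e ->
  `|u - v| <= (2 * e)^-1 * (u * ln (u / v) + (v - u)) + e * (u + v).
Proof.
move=> u0 v0 e0; set a := Num.sqrt u; set b := Num.sqrt v.
have a0 : 0 < a by rewrite sqrtr_gt0.
have b0 : 0 < b by rewrite sqrtr_gt0.
have ua : u = a ^+ 2 by rewrite sqr_sqrtr// ltW.
have vb : v = b ^+ 2 by rewrite sqr_sqrtr// ltW.
have H := sqr_sub_le_ln a0 b0; rewrite -ua -vb in H.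
have E0 : 0 < (2 * e)^-1 by rewrite invr_gt0 mulr_gt0.
apply: (@le_trans _ _ ((2 * e)^-1 * (a - b) ^+ 2 + e * (u + v))); last first.
  by rewrite lerD2r ler_wpM2l ?(ltW E0)// addrA.
have -> : `|u - v| = `|a - b| * (a + b).
  by rewrite -[X in _ * X]gtr0_norm ?addr_gt0// -normrM ua vb -subr_sqr.
rewrite -(real_normK (num_real (a - b))); set d := `|a - b|.
have ee : (2 * e)^-1 * (2 * e) = 1 by rewrite mulVf// gt_eqF// mulr_gt0.
have h1 : 0 <= (2 * e)^-1 * (d - e * (a + b)) ^+ 2 by rewrite mulr_ge0 ?sqr_ge0// ltW.
have h2 : (2 * e)^-1 * (d - e * (a + b)) ^+ 2 =
    (2 * e)^-1 * d ^+ 2 - (2 * e)^-1 * (2 * e) * (d * (a + b)) +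
    (2 * e)^-1 * (2 * e) * (e * (a + b) ^+ 2 / 2) by field; rewrite gt_eqF.
rewrite h2 ee !mul1r in h1.
have h3 : e * (a + b) ^+ 2 / 2 <= e * (u + v).
  rewrite -mulrA ler_wpM2l ?(ltW e0)// ua vb.
  have := sqr_ge0 (a - b); rewrite sqrrB sqrrD; lra.
lra.
Qed.

Context k (u v : Rn R k -> R) (hu : prob_density u) (hv : prob_density v).

Let ell (x : Rn R k) : \bar R :=
  if u x == 0%R then 0%E else if v x == 0%R then +oo%E
  else (u x * ln (u x / v x))%:E.

Let mu_ := prob_density_measurable hu.
Let mv := prob_density_measurable hv.
Let u0 := prob_density_ge0 hu.
Let v0 := prob_density_ge0 hv.

Let mell : measurable_fun setT ell.
Proof.
have -> : ell = fun x => if u x == 0%R then 0%E else if v x == 0%R then +oo%E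
    else (u x * (ln (u x) - ln (v x)))%:E.
  apply/funext => x; rewrite /ell; have [//|ux] := eqVneq (u x) 0.
  have [//|vx] := eqVneq (v x) 0.
  by rewrite ln_div// posrE lt0r ?ux ?vx ?u0 ?v0.
apply: measurable_fun_ifT => //; first exact: measurable_fun_eqr.
apply: measurable_fun_ifT => //; first exact: measurable_fun_eqr.
apply/measurable_EFinP; apply: measurable_funM => //.
by apply: measurable_funB; apply: measurableT_comp => //; exact: measurable_ln.
Qed.

(** Adding [v - u] keeps the integral, both masses being [1], and makes the entropy integrand
    nonnegative. *)
Let N (x : Rn R k) := (ell x + (v x - u x)%:E)%E.

Let dist_le (x : Rn R k) (e : R) : 0 < e ->
  (`|u x - v x|%:E <= (2 * e)^-1%:E * N x + (e * (u x + v x))%:E)%E /\ (0 <= N x)%E.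
Proof.
move=> e0; have E0 : 0 < (2 * e)^-1 by rewrite invr_gt0 mulr_gt0.
rewrite /N /ell; have [ux|ux] := eqVneq (u x) 0.
  rewrite ux add0e subr0 !add0r normrN ger0_norm// !lee_fin; split=> //.
  rewrite -mulrDl ler_peMl// -(ler_pM2r (_ : 0 < 2 * e)) ?mulr_gt0//.
  rewrite mul1r mulrDl mulVf ?gt_eqF ?mulr_gt0//.
  have := sqr_ge0 (e - 1); rewrite sqrrB expr2; have := sqr_ge0 e; rewrite expr2; lra.
have [vx|vx] := eqVneq (v x) 0.
  by rewrite addye// gt0_muley ?lte_fin// addye//; split; exact: leey.
have ux0 : 0 < u x by rewrite lt0r ux u0.
have vx0 : 0 < v x by rewrite lt0r vx v0.
split; first exact: (dist_le_entropy ux0 vx0 e0).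
rewrite -EFinD lee_fin.
have := sqr_sub_le_ln (_ : 0 < Num.sqrt (u x)) (_ : 0 < Num.sqrt (v x)).
rewrite !sqrtr_gt0 !sqr_sqrtr ?u0 ?v0// => /(_ ux0 vx0); rewrite -addrA.
by apply: le_trans; exact: sqr_ge0.
Qed.

Lemma dTV_le_relative_entropy (d e : R) : 0 < e ->
  (relative_entropy u v <= d%:E)%E -> (dTV u v <= ((2 * e)^-1 * d + 2 * e)%:E)%E.
Proof.
move=> e0 le_d; have E0 : 0 < (2 * e)^-1 by rewrite invr_gt0 mulr_gt0.
have hiu : has_integral (lebesgue_Rn k) u 1.
  split; last exact: prob_density_int1.
  apply/integrableP; split; first exact/measurable_EFinP.
  under eq_integral do rewrite /= ger0_norm//.
  by rewrite prob_density_int1// ltry.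
have hiv : has_integral (lebesgue_Rn k) v 1.
  split; last exact: prob_density_int1.
  apply/integrableP; split; first exact/measurable_EFinP.
  under eq_integral do rewrite /= ger0_norm//.
  by rewrite prob_density_int1// ltry.
have [iw ew] := has_integralD hiv (has_integralZ (-1) hiu).
have [isum es] := has_integralZ e (has_integralD hiu hiv).
(* An upper bound on the entropy alone does not make [ell] integrable. Nonnegativity of [N] bounds
   its negative part by [v], after which the bound [d] controls the positive part. *)
have neg : (\int[lebesgue_Rn k]_x (ell^\- x) <= 1)%E.
  rewrite -(prob_density_int1 hv); apply: ge0_le_integral => //.
  - by apply: measurable_funeneg.
  - exact/measurable_EFinP.
  move=> x _; rewrite funenegE ge_max lee_fin v0 andbT leeNl.
  have := (dist_le x e0).2; rewrite /N.
  case: (ell x) => [r||]; last by rewrite addNye leNgt ltNye.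
    by rewrite -EFinD -EFinN !lee_fin => h; have := u0 x; lra.
  by move=> _; rewrite leey.
have negfin : (\int[lebesgue_Rn k]_x (ell^\- x))%E \is a fin_num.
  by rewrite ge0_fin_numE ?integral_ge0// (le_lt_trans neg) ?ltry.
have iell : (lebesgue_Rn k).-integrable setT ell.
  apply/integrableP; split=> //.
  rewrite (_ : (fun x => `|ell x|%E) = (ell^\+ \+ ell^\-)%E); last by rewrite -fune_abse.
  rewrite ge0_integralD//; [|exact: measurable_funepos|exact: measurable_funeneg].
  rewrite lte_add_pinfty//; last by rewrite (le_lt_trans neg) ?ltry.
  have : (\int[lebesgue_Rn k]_x ell x <= d%:E)%E by [].
  rewrite [leLHS]integralE leeBlDr// => /le_lt_trans; apply.
  by rewrite lte_add_pinfty ?ltry// (le_lt_trans neg) ?ltry.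
have NE x : N x = (ell x + (v x + -1 * u x)%:E)%E by rewrite /N mulN1r.
have iN : (lebesgue_Rn k).-integrable setT N.
  by rewrite (funext NE); exact: integrableD.
have eN : (\int[lebesgue_Rn k]_x N x <= d%:E)%E.
  under eq_integral do rewrite NE.
  by rewrite integralD// ew mulr1 subrr adde0.
apply: (@le_trans _ _ (\int[lebesgue_Rn k]_x
    ((2 * e)^-1%:E * N x + (e * (u x + v x))%:E))%E).
  apply: ge0_le_integral => //.
  - apply/measurable_EFinP; apply: measurableT_comp => //; exact: measurable_funB.
  - apply: emeasurable_funD; last by have /measurable_int := isum.
    by apply: measurable_funeM; have /measurable_int := iN.
  - by move=> x _; exact: (dist_le x e0).1.
rewrite integralD//; last exact: integrableZl.
rewrite integralZl// es EFinD leeD//; last by rewrite lee_fin; lra.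
by rewrite EFinM lee_wpmul2l// lee_fin ltW.
Qed.

End pinsker.

(** * Choice of constants and conclusion *)

Section ratio.
Context {R : realType} (f : R -> \bar R) (hf : classF f) (t c : R) (t0 : 0 < t) (c0 : 0 < c)
  (hmean : (\int[@lebesgue_measure R]_x
       ((gibbs f c ([tuple x] : Rn R 1))%:E * f x) = t%:E)%E).

Lemma prob_density_gibbs n : prob_density (@gibbs R f c n).
Proof.
have [s [K [_ mom]]] := wsum_moments hf t0 c0 hmean.
split; [exact: measurable_gibbs|exact: (gibbs_ge0 hf t0 c0 hmean)|].
by have [[_ ->]] := mom n (fun=> 0).
Qed.

Lemma cvg_ratio (k : nat -> nat) (A : forall n, R -> Rn R n -> R)
    (p : forall n, Rn R (k n) -> R) :
  (forall n, (2 <= n)%N -> (1 <= k n < n)%N) ->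
  (forall n, (2 <= n)%N -> is_jacobian f t (A n)) ->
  (forall n, (2 <= n)%N -> marginal_density f t (A n) (p n)) ->
  (forall d : R, 0 < d -> \forall n \near \oo, (dTV (p n) (@gibbs R f c (k n)) <= d%:E)%E) ->
  ((k n)%:R / n%:R : R) @[n --> \oo] --> (0 : R).
Proof.
move=> hk hA hp hd; have [s [K [s0 [K0 H]]]] := block_inequality hf t0 c0 hmean.
apply/cvgr0Pnorm_le => e e0.
(* Bounds the number of blocks: if [k > e n], then [3 b >= k] gives [n / b <= 3 / e]. *)
pose M := 3 / e + 1.
have M1 : 1 <= M by rewrite lerDr divr_ge0// ltW.
have M0 : 0 < M := lt_le_trans ltr01 M1.
(* [L2] brings the fourth-moment error below [s b / 4], and [d] below does the same for the [d_TV]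
   error. The inequality then reads [s n <= s b / 2], against [b <= n]. The [+ 1] keeps [L2]
   positive when [K = 0]. *)
pose L2 := 4 * M ^+ 2 * (M + 2) * K / s + 1.
have L20 : 0 < L2.
  apply: ltr_wpDl => //; rewrite divr_ge0 ?(ltW s0)// mulr_ge0//.
  by rewrite !mulr_ge0 ?sqr_ge0 ?(ltW M0)// addr_ge0 ?(ltW M0).
pose d := s / (8 * M ^+ 3 * L2).
have d0 : 0 < d by rewrite divr_gt0// !mulr_gt0// exprn_gt0.
near=> n.
have n2 : (2 <= n)%N by near: n; exact: nbhs_infty_ge.
(* Ensures [k >= 2], so that half of [k] is a positive block size. *)
have ne : 2 / e <= n%:R by near: n; exact: nbhs_infty_ger.
have dn : (dTV (p n) (@gibbs R f c (k n)) <= d%:E)%E by near: n; exact: hd.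
have n0 : 0 < n%:R :> R by rewrite ltr0n (leq_trans _ n2).
rewrite ger0_norm ?divr_ge0// leNgt; apply/negP; rewrite ltr_pdivlMr// => ek.
have k2 : (2 <= k n)%N.
  rewrite -(ler_nat R) (le_trans _ (ltW ek))//.
  by rewrite mulrC -ler_pdivrMr.
have kn : (2 <= k n <= n)%N by rewrite k2 ltnW//; have /andP[] := hk n n2.
pose b := ((k n)./2)%N; pose m := (n %/ b).+1.
have b0N : (0 < b)%N by rewrite half_gt0.
have b0 : 0 < b%:R :> R by rewrite ltr0n.
have kb : (k n)%:R <= 3 * b%:R :> R.
  rewrite -natrM ler_nat -[leqLHS]odd_double_half -/b -addnn mulSn mul2n -addnn leq_add2r.
  by apply: leq_trans b0N; case: odd.
have mM : m%:R <= M.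
  rewrite /m -natr1 lerD2r ler_pdivlMr//.
  have : (n %/ b)%:R * b%:R <= n%:R :> R by rewrite -natrM ler_nat leq_divM.
  rewrite -(ler_pM2r e0) => h.
  rewrite -(ler_pM2r b0); apply: (le_trans _ kb); apply: (le_trans _ (ltW ek)).
  by rewrite mulrAC [leRHS]mulrC.
have Lam0 : 0 < Num.sqrt (L2 * b%:R) by rewrite sqrtr_gt0 mulr_gt0.
have := H n (k n) (A n) (p n) d _ kn (hA n n2) (hp n n2) dn Lam0 b m erefl erefl.
rewrite sqr_sqrtr; last by rewrite mulr_ge0// ltW.
apply/negP; rewrite -ltNge.
have bn : b%:R <= n%:R :> R.
  have /andP[_ kn'] := kn; rewrite ler_nat (leq_trans _ kn')//.
  by rewrite -[leqRHS]odd_double_half -addnn addnA leq_addl.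
have m0 : 0 <= m%:R :> R by [].
have i1 : m%:R ^+ 2 * (m.+2%:R * (K * b%:R ^+ 2 / (L2 * b%:R))) <=
    M ^+ 2 * (M + 2) * K / L2 * b%:R.
  rewrite [leLHS](_ : _ = m%:R ^+ 2 * m.+2%:R * (K / L2 * b%:R)); last first.
    by field; rewrite !gt_eqF.
  rewrite [leRHS](_ : _ = M ^+ 2 * (M + 2) * (K / L2 * b%:R)); last by ring.
  rewrite ler_wpM2r ?mulr_ge0 ?invr_ge0 ?(ltW L20)//.
  rewrite ler_pM ?exprn_ge0// ?lerXn2r ?nnegrE ?(ltW M0)//.
  by rewrite -addn2 natrD lerD2r.
have i2 : m%:R ^+ 2 * (2 * (m%:R * (L2 * b%:R)) * d) <= s / 4 * b%:R.
  rewrite [leLHS](_ : _ = m%:R ^+ 3 * (2 * L2 * d * b%:R)); last by ring.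
  apply: (@le_trans _ _ (M ^+ 3 * (2 * L2 * d * b%:R))).
    apply: ler_wpM2r; last by rewrite lerXn2r ?nnegrE ?(ltW M0).
    exact: mulr_ge0 (mulr_ge0 (mulr_ge0 (ler0n _ 2) (ltW L20)) (ltW d0)) (ltW b0).
  by rewrite le_eqVlt /d; apply/orP; left; apply/eqP; field; rewrite !gt_eqF.
have i3 : M ^+ 2 * (M + 2) * K / L2 <= s / 4.
  rewrite ler_pdivrMr// /L2 [leRHS]mulrDr mulr1.
  rewrite [X in _ <= X + _](_ : _ = M ^+ 2 * (M + 2) * K); first by rewrite lerDl divr_ge0 ?ltW.
  by field; rewrite gt_eqF.
rewrite mulrDr; apply: (le_lt_trans (lerD i1 i2)).
apply: (@lt_le_trans _ _ (s * b%:R)); last by rewrite ler_wpM2l ?(ltW s0).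
have := ler_wpM2r (ltW b0) i3; have := mulr_gt0 s0 b0; lra.
Unshelve. all: by end_near. Qed.

End ratio.

Lemma cvge0_le (R : realType) (u : nat -> \bar R) : u n @[n --> \oo] --> 0%E ->
  forall d : R, 0 < d -> \forall n \near \oo, (u n <= d%:E)%E.
Proof.
move=> /fine_cvgP[fu u0] d d0; near=> n.
rewrite -[u n]fineK; last by near: n.
rewrite lee_fin; near: n; exact: (cvgr_le _ u0).
Unshelve. all: by end_near. Qed.

Theorem proposition4p1 (R : realType) (f : R -> \bar R) (t c : R)
    (k : nat -> nat)
    (A : forall n, R -> Rn R n -> R)
    (p : forall n, Rn R (k n) -> R)
    (hf : classF f) (ht : 0 < t) (hc : 0 < c)
    (hmean : (\int[@lebesgue_measure R]_x
       ((gibbs f c ([tuple x] : Rn R 1))%:E * f x) = t%:E)%E)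
    (hk : forall n, (2 <= n)%N -> (1 <= k n < n)%N)
    (hA : forall n, (2 <= n)%N -> is_jacobian f t (A n))
    (hp : forall n, (2 <= n)%N -> marginal_density f t (A n) (p n)) :
  (dTV (p n) (@gibbs R f c (k n)) @[n --> \oo] --> 0%E ->
     ((k n)%:R / n%:R : R) @[n --> \oo] --> (0 : R)) /\
  (relative_entropy (p n) (@gibbs R f c (k n)) @[n --> \oo] --> 0%E ->
     ((k n)%:R / n%:R : R) @[n --> \oo] --> (0 : R)).
Proof.
split=> /cvge0_le hlim; apply: (cvg_ratio hf ht hc hmean hk hA hp) => // d d0.
(* With [e = d / 4] and entropy at most [d ^ 2 / 4], both terms of [dTV_le_relative_entropy] equal
   [d / 2]. *)
have e0 : 0 < d / 4 by rewrite divr_gt0.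
near=> n.
have n2 : (2 <= n)%N by near: n; exact: nbhs_infty_ge.
have [pn _] := hp n n2.
have le_n : (relative_entropy (p n) (@gibbs R f c (k n)) <= (d ^+ 2 / 4)%:E)%E.
  by near: n; apply: hlim; rewrite divr_gt0// exprn_gt0.
have := dTV_le_relative_entropy pn (prob_density_gibbs hf ht hc hmean (k n)) e0 le_n.
rewrite (_ : _ + _ = d)//.
by field; rewrite gt_eqF.
Unshelve. all: by end_near. Qed.
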